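(* Let $\gamma \subset \mathbb{C}$ be an analytic curve and let $P(z) \in \mathcal{C}_{0}^{\omega}[z]$ be a monic polynomial of degree $d \geq 1$ that has roots in $\gamma$. Then $P(z)$ is completely reducible, i.e. $P(z)$ factors into monic polynomials of degree one in $\mathcal{C}_{0}^{\omega}[z]$.
   Context: For $r>0$ let $\mathbb{D}_r = \{ z \in \mathbb{C} : |z| < r \}$ and let $A(\mathbb{D}_r)$ be the ring of (complex) analytic functions on $\mathbb{D}_r$. $\mathcal{C}_{0}^{\omega}$ denotes the ring of power series with complex coefficients that converge absolutely in $\mathbb{D}_r$ for some $r>0$ (depending on the series); equivalently, the ring of germs at $0$ of functions in $\bigcup_{r>0} A(\mathbb{D}_r)$. $\mathcal{C}_{0}^{\omega}[z]$ is the ring of polynomials in the indeterminate $z$ with coefficients in $\mathcal{C}_{0}^{\omega}$. Let $P(z) \in \mathcal{C}_{0}^{\omega}[z]$ be monic of degree $d \geq 1$. There are $r>0$ and $a_0,\dots,a_{d-1} \in A(\mathbb{D}_r)$ with $P(z) = z^d + a_{d-1} z^{d-1} + \cdots + a_1 z + a_0$. For $w \in \mathbb{D}_r$ define $P_w(z) = z^d + a_{d-1}(w) z^{d-1} + \cdots + a_1(w) z + a_0(w) \in \mathbb{C}[z]$. For $\gamma \subset \mathbb{C}$, $P(z)$ ''has roots in $\gamma$'' if there exists $s \in (0,r]$ such that for every real $t \in (-s,s)$ all (complex) roots of $P_t(z)$ are in $\gamma$. $P(z)$ is ''completely reducible'' if it factors into monic polynomials in $\mathcal{C}_{0}^{\omega}[z]$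 of degree one; equivalently (for $P(z)$ having roots in $\gamma$), if, for $r>0$ such that $a_0,\dots,a_{d-1} \in A(\mathbb{D}_r)$ and $s \in (0,r]$ such that for every real $t \in (-s,s)$ all roots of $P_t(z)$ are in $\gamma$, there exist $u \in (0,s]$ and $\lambda_1,\dots,\lambda_d \in A(\mathbb{D}_u)$ such that for every $w \in \mathbb{D}_u$, $\lambda_1(w),\dots,\lambda_d(w)$ are the roots (with multiplicity) of $P_w(z)$. A subset $\gamma \subset \mathbb{C}$ is an ''analytic curve'' if it is a real analytic submanifold of $\mathbb{C} \cong \mathbb{R}^2$ of dimension $1$: for every $p \in \gamma$ there exist $\epsilon > 0$, an open neighborhood $U$ of $p$ in $\gamma$ (for the subspace topology), and a real analytic diffeomorphism $f : (-\epsilon,\epsilon) \to U$ with $f(0)=p$ (that is, $f$ is real analytic as a map into $\mathbb{C}$, is a homeomorphism onto $U$, and has nowhere vanishing derivative; in particular $f'(0) \neq 0$). *)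

(* Defs.v *)
From HB Require Import structures.
From mathcomp Require Import all_boot all_order all_algebra.
From mathcomp Require Import complex.
From mathcomp Require Import all_classical all_reals all_analysis.

Set Implicit Arguments.
Unset Strict Implicit.
Unset Printing Implicit Defensive.

Import Order.TTheory GRing.Theory Num.Theory.
Import numFieldNormedType.Exports.
Import ComplexField.Normc.

Local Open Scope ring_scope.
Local Open Scope complex_scope.
Local Open Scope classical_set_scope.

(* The library puts the norm topology on R[i]^o only; transfer it to R[i]. *)
HB.instance Definition _ (R : realType) := NormedModule.copy R[i] R[i]^o.

Section PowerSeries.
Variable R : realType.
Implicit Types a b c : nat -> R[i].

Definition abs_cvg_on (r : R) a : Prop :=
  forall z : R[i], normc z < r -> cvgn (series (fun n => normc (a n * z ^+ n))).

Definition convergent a : Prop := exists2 r : R, 0 < r & abs_cvg_on r a.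

Definition ps_zero : nat -> R[i] := fun=> 0.
Definition ps_one : nat -> R[i] := fun n => (n == 0%N)%:R.
Definition ps_opp a : nat -> R[i] := fun n => - a n.
Definition ps_add a b : nat -> R[i] := fun n => a n + b n.
Definition ps_mul a b : nat -> R[i] :=
  fun n => \sum_(i < n.+1) a i * b (n - i)%N.

Lemma normc_ge0 (x : R[i]) : 0 <= normc x.
Proof. by case: x => x y; rewrite sqrtr_ge0. Qed.

Lemma normc_le_add (x y : R[i]) : normc (x + y) <= normc x + normc y.
Proof. exact: le_normcD. Qed.

Lemma normc_opp (x : R[i]) : normc (- x) = normc x.
Proof. exact: normcN. Qed.

Lemma normc_le_sum n (F : 'I_n -> R[i]) :
  normc (\sum_(i < n) F i) <= \sum_(i < n) normc (F i).
Proof.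
elim/big_ind2 : _ => [|x u y v xu yv|//]; first by rewrite normc0.
by apply: le_trans (normc_le_add _ _) _; exact: lerD.
Qed.

Lemma bounded_nneg_cvg (u : nat -> R) (M : R) :
  (forall n, 0 <= u n) -> (forall n, series u n <= M) -> cvgn (series u).
Proof.
move=> u0 uM; apply: nondecreasing_is_cvgn.
  exact: nondecreasing_series.
by exists M => _ [n _ <-].
Qed.

Lemma nneg_series_le (u : nat -> R) n :
  (forall n, 0 <= u n) -> cvgn (series u) -> series u n <= limn (series u).
Proof.
by move=> u0 cu; apply: nondecreasing_cvgn_le => //; exact: nondecreasing_series.
Qed.

Lemma convergent_zero : convergent ps_zero.
Proof.
exists 1 => // z _; apply: (@bounded_nneg_cvg _ 0) => n; first exact: normc_ge0.
by rewrite /series /= big1// => i _; rewrite mul0r normc0.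
Qed.

Lemma convergent_one : convergent ps_one.
Proof.
exists 1 => // z _; apply: (@bounded_nneg_cvg _ 1) => n; first exact: normc_ge0.
rewrite /series /=; case: n => [|n]; first by rewrite big_nil.
rewrite big_nat_recl// [ps_one 0%N]/ps_one eqxx mul1r expr0 normc1 big1 ?addr0// => i _.
by rewrite /ps_one /= mul0r normc0.
Qed.

Lemma convergent_opp a : convergent a -> convergent (ps_opp a).
Proof.
move=> [r r0 ar]; exists r => // z /ar.
by under [X in _ -> cvgn (series X)]eq_fun do rewrite /ps_opp mulNr normc_opp.
Qed.

Lemma convergent_add a b :
  convergent a -> convergent b -> convergent (ps_add a b).
Proof.
move=> [r r0 ar] [s s0 bs]; exists (Num.min r s); first by rewrite lt_min r0.
move=> z; rewrite lt_min => /andP[/ar ca /bs cb].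
set u := (fun n => normc (a n * _)) in ca; set v := (fun n => normc (b n * _)) in cb.
apply: (@bounded_nneg_cvg _ (limn (series u) + limn (series v))) => n.
  exact: normc_ge0.
have u0 k : 0 <= u k by exact: normc_ge0.
have v0 k : 0 <= v k by exact: normc_ge0.
apply: le_trans (lerD (nneg_series_le n u0 ca) (nneg_series_le n v0 cb)).
rewrite /series /= -big_split/=; apply: ler_sum => i _.
by rewrite /ps_add mulrDl; exact: normc_le_add.
Qed.

Lemma convergent_mul a b :
  convergent a -> convergent b -> convergent (ps_mul a b).
Proof.
move=> [r r0 ar] [s s0 bs]; exists (Num.min r s); first by rewrite lt_min r0.
move=> z; rewrite lt_min => /andP[/ar ca /bs cb].
set u := (fun n => normc (a n * _)) in ca; set v := (fun n => normc (b n * _)) in cb.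
have u0 k : 0 <= u k by exact: normc_ge0.
have v0 k : 0 <= v k by exact: normc_ge0.
apply: (@bounded_nneg_cvg _ (limn (series u) * limn (series v))) => N.
  exact: normc_ge0.
have sge0 (w : nat -> R) : (forall k, 0 <= w k) -> 0 <= series w N.
  by move=> w0; exact: sumr_ge0.
apply: le_trans (ler_pM (sge0 _ u0) (sge0 _ v0)
  (nneg_series_le N u0 ca) (nneg_series_le N v0 cb)).
pose p := \poly_(i < N) u i; pose q := \poly_(i < N) v i.
have hor (w : nat -> R) : (\poly_(i < N) w i).[1] = series w N.
  rewrite (horner_coef_wide 1 (size_poly _ _)) /series /= big_mkord.
  by apply: eq_bigr => i _; rewrite expr1n mulr1 coef_poly ltn_ord.
rewrite -(hor u) -(hor v) -/p -/q -hornerM.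
have c0 k : 0 <= (p * q)`_k.
  rewrite coefM; apply: sumr_ge0 => i _; rewrite !coef_poly.
  by apply: mulr_ge0; case: ifP.
have sz : (size (p * q)%R <= N + size (p * q)%R)%N by rewrite leq_addl.
rewrite (horner_coef_wide 1 sz) big_split_ord/=.
rewrite -[leLHS]addr0; apply: lerD; last first.
  by apply: sumr_ge0 => i _; rewrite expr1n mulr1.
rewrite /series /= big_mkord; apply: ler_sum => i _.
rewrite expr1n mulr1 /ps_mul mulr_suml coefM.
apply: le_trans (normc_le_sum _) _; apply: ler_sum => j _.
have jN : (j < N)%N by rewrite (leq_ltn_trans _ (ltn_ord i))// -ltnS.
have ijN : (i - j < N)%N by rewrite (leq_ltn_trans _ (ltn_ord i))// leq_subr.
rewrite !coef_poly jN ijN /u /v -normcM le_eqVlt; apply/orP; left.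
by rewrite mulrACA -exprD subnKC// -ltnS.
Qed.

End PowerSeries.

(* The ring C_0^omega: a germ at 0 is represented by its Taylor coefficients, so
   the ring laws below are those of power series (Cauchy product), not the
   pointwise ones of nat -> R[i]. *)
Record germ (R : realType) :=
  Germ { coef_germ :> nat -> R[i]; _ : `[< convergent coef_germ >] }.

HB.instance Definition _ (R : realType) := [isSub for @coef_germ R].
HB.instance Definition _ (R : realType) := [Choice of germ R by <:].

Section GermRing.
Variable R : realType.
Implicit Types a b c : germ R.

Lemma germ_convergent a : convergent a.
Proof. by case: a => a /= /asboolP. Qed.

Definition mk_germ (u : nat -> R[i]) (cu : convergent u) : germ R :=
  Germ (asboolT cu).

Lemma germP a b : (forall n, a n = b n) -> a = b.
Proof. by move=> ab; apply/val_inj/funext. Qed.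

Definition germ_zero := mk_germ (convergent_zero R).
Definition germ_one := mk_germ (convergent_one R).
Definition germ_opp a := mk_germ (convergent_opp (germ_convergent a)).
Definition germ_add a b :=
  mk_germ (convergent_add (germ_convergent a) (germ_convergent b)).
Definition germ_mul a b :=
  mk_germ (convergent_mul (germ_convergent a) (germ_convergent b)).

Lemma germ_addA : associative germ_add.
Proof. by move=> a b c; apply: germP => n; exact: addrA. Qed.
Lemma germ_addC : commutative germ_add.
Proof. by move=> a b; apply: germP => n; exact: addrC. Qed.
Lemma germ_add0 : left_id germ_zero germ_add.
Proof. by move=> a; apply: germP => n; exact: add0r. Qed.
Lemma germ_addN : left_inverse germ_zero germ_opp germ_add.
Proof. by move=> a; apply: germP => n; exact: addNr. Qed.

HB.instance Definition _ :=
  GRing.isZmodule.Build (germ R) germ_addA germ_addC germ_add0 germ_addN.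

Let trunc a N : {poly R[i]} := \poly_(i < N) a i.

Let trunc_mul a b N n : (n < N)%N ->
  (germ_mul a b) n = (trunc a N * trunc b N)`_n.
Proof.
move=> nN; rewrite coefM; apply: eq_bigr => i _; rewrite !coef_poly.
rewrite (leq_ltn_trans (leq_subr _ _) nN).
by rewrite (leq_ltn_trans _ nN)// -ltnS.
Qed.

Let coef_mul_trunc (p q p' q' : {poly R[i]}) n :
  (forall i, (i <= n)%N -> p`_i = p'`_i) ->
  (forall i, (i <= n)%N -> q`_i = q'`_i) -> (p * q)`_n = (p' * q')`_n.
Proof.
move=> pp qq; rewrite !coefM; apply: eq_bigr => i _.
by rewrite pp -1?ltnS// qq// leq_subr.
Qed.

Lemma germ_mulC : commutative germ_mul.
Proof.
by move=> a b; apply: germP => n; rewrite !(@trunc_mul _ _ n.+1)// mulrC.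
Qed.

Lemma germ_mulA : associative germ_mul.
Proof.
move=> a b c; apply: germP => n; rewrite !(@trunc_mul _ _ n.+1)//.
transitivity ((trunc a n.+1 * (trunc b n.+1 * trunc c n.+1))`_n).
  apply: coef_mul_trunc => // i ni.
  by rewrite coef_poly ltnS ni (@trunc_mul _ _ n.+1).
rewrite mulrA; apply: coef_mul_trunc => // i ni.
by rewrite coef_poly ltnS ni (@trunc_mul _ _ n.+1).
Qed.

Lemma germ_mul1 : left_id germ_one germ_mul.
Proof.
move=> a; apply: germP => n; rewrite /= /ps_mul big_ord_recl /= /ps_one eqxx.
rewrite mul1r subn0 big1 ?addr0// => i _.
by rewrite /= mul0r.
Qed.

Lemma germ_mulDl : left_distributive germ_mul germ_add.
Proof.
move=> a b c; apply: germP => n; rewrite /= /ps_add /ps_mul -big_split/=.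
by apply: eq_bigr => i _; rewrite mulrDl.
Qed.

Lemma germ_one_neq0 : germ_one != germ_zero.
Proof.
apply/eqP => /(congr1 (fun a : germ R => a 0%N)) /eqP.
by rewrite /= /ps_one /ps_zero eqxx oner_eq0.
Qed.

HB.instance Definition _ := GRing.Zmodule_isComNzRing.Build (germ R)
  germ_mulA germ_mulC germ_mul1 germ_mulDl germ_one_neq0.

(* `limn` is total; this is the value of the germ only where its series
   converges. *)
Definition germ_eval (w : R[i]) a : R[i] :=
  limn (series (fun n => a n * w ^+ n)).

End GermRing.

Section RootsInCurve.
Variable R : realType.

Definition specialize (P : {poly germ R}) (w : R[i]) : {poly R[i]} :=
  map_poly (germ_eval w) P.

Definition has_roots_in (gamma : set R[i]) (P : {poly germ R}) : Prop :=
  exists2 r : R, 0 < r & (forall j : nat, abs_cvg_on r P`_j) /\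
    exists2 s : R, 0 < s <= r &
      forall t : R, - s < t < s ->
        forall z : R[i], root (specialize P t%:C) z -> gamma z.

Definition completely_reducible (P : {poly germ R}) : Prop :=
  exists2 s : seq {poly germ R},
    (forall q, q \in s -> q \is monic /\ size q = 2%N) & P = \prod_(q <- s) q.

Definition real_analytic_at (f : R -> R[i]) (t0 : R) : Prop :=
  exists c : nat -> R[i], \forall t \near t0,
    series (fun n => c n * (t - t0)%:C ^+ n) @ \oo --> f t.

(* The library's derivative of a map from R needs a normed R-module as target,
   whereas R[i] is normed over itself: hence the explicit difference quotient. *)
Definition has_nonzero_derivative_at (f : R -> R[i]) (t0 : R) : Prop :=
  exists2 l : R[i], l != 0 & (h^-1)%:C * (f (t0 + h) - f t0) @[h --> 0^'] --> l.

Definition homeomorphism_onto (I : set R) (U : set R[i]) (f : R -> R[i]) : Prop :=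
  [/\ f @` I = U, {within I, continuous f} &
    exists2 g : R[i] -> R,
      (forall t, I t -> g (f t) = t) & {within U, continuous g}].

(* f is total; its values outside `]-e, e[ play no role. *)
Definition analytic_curve (gamma : set R[i]) : Prop :=
  forall p : R[i], gamma p ->
    exists2 e : R, 0 < e &
    exists (V : set R[i]) (f : R -> R[i]),
      [/\ open V, V p, f 0 = p,
          homeomorphism_onto [set t | - e < t < e] (gamma `&` V) f &
          forall t : R, - e < t < e ->
            real_analytic_at f t /\ has_nonzero_derivative_at f t].

End RootsInCurve.

(* Main.v *)
Require Import Defs.
From HB Require Import structures.
From mathcomp Require Import all_boot all_order all_algebra.
From mathcomp Require Import complex.
From mathcomp Require Import all_classical all_reals all_analysis.
From mathcomp Require Import ring lra zify.
Local Open Scope ring_scope.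

(** Over a real parameter [t] near 0, Hensel's lemma ([hensel]) factors [P] according to the
distinct roots of its value [P_0] at 0, so the difficulty is a cluster,
[P_0 = (z - p)^d].  In general the roots of a cluster are power series in a
fractional power of [t], as for [z^2 = t].  Having to stay on a curve for [t] of
both signs excludes this: the differences of roots have to be almost tangent to
the curve, whereas the determinations of a fractional power of [t], for [t] of
both signs, do not all lie on one line.

All that is needed of the curve is that its secants near a point [p] have almost
the direction of its tangent there, in the form: for some complex [kappa] (a
positive multiple of the inverse square of a tangent vector), all [u], [v] on the
curve near [p] satisfy [|u - v|^2 <= Re (kappa (u - v)^2)]
([cone], [analytic_curve_cone]).  Unlike membership in the curve, this condition
on the roots survives a translation of all roots by the same amount and a scaling
by a nonzero real number, so that it can be carried through an induction on the
degree ([aligned], [aligned_splits]).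

For a cluster of [d >= 2] roots [x_i], let [D] be the sum of all
[(x_i - x_j)^2].  It is a polynomial in the two coefficients of [P] that follow
the leading one, hence a germ ([spread]).  Summing the condition gives
[sum |x_i - x_j|^2 <= Re (kappa D)] and [|D| <= Re (kappa D)].  If [D = 0], all
roots are equal to their mean, which is a germ, and [P] splits
([spread_eq0_splits]).  Otherwise [D = t^k b] with [b] nonzero at 0.  As
[Re (kappa D)] is positive on both sides of 0, the order [k] is even
([order_even]), say [k = 2m].  So the roots differ from their mean [c] by
[O(|t|^m)], and the growth of the coefficients of [P (z + c)] shows that they are
divisible by the powers of [t] that make [Q(z) = t^(- m d) P (t^m z + c)] a
monic polynomial over the germs ([zoom_exists]).  The condition holds for all the roots
of [Q], and the sum [D] for [Q] is [b], which is nonzero at 0: therefore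
[Q_0] has two distinct roots, and Hensel's lemma reduces [Q] to factors of lower
degree ([split_clusters]).  Undoing the substitution splits [P] ([zoom_splits]). *)

Set Implicit Arguments.
Unset Strict Implicit.
Unset Printing Implicit Defensive.

Import Order.TTheory GRing.Theory Num.Theory.
Import numFieldNormedType.Exports.
Import ComplexField.Normc.

Local Open Scope complex_scope.
Local Open Scope classical_set_scope.

Local Arguments normc : simpl never.

(** * Moduli and limits of complex numbers *)

Section Modulus.
Variable R : realType.
Implicit Types (z w : R[i]) (x : R).

Lemma normcX z n : normc (z ^+ n) = normc z ^+ n.
Proof. by elim: n => [|n IH]; rewrite ?expr0 ?normc1// !exprS normcM IH. Qed.

Lemma normcR x : normc x%:C = `|x|.
Proof. by rewrite /normc /= expr0n/= addr0 sqrtr_sqr. Qed.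

Lemma normcB z w : normc (z - w) = normc (w - z).
Proof. by rewrite -normc_opp opprB. Qed.

Lemma normc_eq0 z : (normc z == 0) = (z == 0).
Proof.
by apply/eqP/eqP => [/eq0_normc//|->]; rewrite normc0.
Qed.

Lemma normc_gt0 z : (0 < normc z) = (z != 0).
Proof. by rewrite lt_def normc_eq0 normc_ge0 andbT. Qed.

Lemma normCE z : `|z| = (normc z)%:C.
Proof. by case: z. Qed.

Lemma Re_le_normc z : `|complex.Re z| <= normc z.
Proof. by have := normc_ge_Re z; rewrite normCE lecR. Qed.

Lemma Im_le_normc z : `|complex.Im z| <= normc z.
Proof.
case: z => a b /=; rewrite -(sqrtr_sqr b) ler_wsqrtr// lerDr.
exact: sqr_ge0.
Qed.

Lemma normc_le_ReIm z : normc z <= `|complex.Re z| + `|complex.Im z|.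
Proof.
rewrite [in leLHS](complexE z); apply: le_trans (normc_le_add _ _) _.
by rewrite normcM !normcR /normc /= expr0n expr1n add0r sqrtr1 mul1r.
Qed.

(** The norm of [R[i]] takes its values in [R[i]]; this restates convergence
   with the real modulus, in which all estimates below are made. *)
Lemma cvgcP {I : Type} (F : set_system I) {FF : Filter F} (u : I -> R[i]) (l : R[i]) :
  u @ F --> l <-> (forall e : R, 0 < e -> \forall n \near F, normc (l - u n) < e).
Proof.
split=> [/cvgrPdist_lt ul e e0|ul].
  have := ul e%:C; rewrite ltcR => /(_ e0).
  by apply: filterS => n; rewrite normCE ltcR.
apply/cvgrPdist_lt => -[a b]; rewrite ltcE/= => /andP[/eqP -> a0].
by apply: filterS (ul _ a0) => n; rewrite normCE ltcR.
Qed.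

Lemma nbhscP (p : R[i]) (A : set R[i]) :
  nbhs p A -> exists2 e : R, 0 < e & forall u, normc (u - p) < e -> A u.
Proof.
move=> /nbhs_normP[[a b]] /=; rewrite ltcE/= => /andP[/eqP -> a0] h.
by exists a => // u up; apply: h; rewrite /ball_/= normCE ltcR normcB.
Qed.

Lemma cvgc_unique (u : nat -> R[i]) (l l' : R[i]) :
  u @ \oo --> l -> u @ \oo --> l' -> l = l'.
Proof.
move=> ul ul'; rewrite -(cvg_lim (@norm_hausdorff _ _) ul).
exact: (cvg_lim (@norm_hausdorff _ _) ul').
Qed.

Lemma cvgc_le (u : nat -> R[i]) (l : R[i]) C :
  u @ \oo --> l -> (forall n, normc (u n) <= C) -> normc l <= C.
Proof.
move=> /cvgcP ul uC; apply/ler_addgt0Pr => e /ul[N _ /(_ N)/= /(_ (leqnn _)) h].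
rewrite -(subrK (u N) l) addrC; apply: le_trans (normc_le_add _ _) _.
by rewrite lerD// ltW.
Qed.

(** The real and imaginary parts are dominated by the modulus, so they
   converge by the completeness of the real line. *)
Lemma abs_cvgc (u : nat -> R[i]) C :
  (forall N, \sum_(n < N) normc (u n) <= C) -> exists v : R[i], series u @ \oo --> v.
Proof.
move=> uC.
have cv (f : R[i] -> R) : (forall z, `|f z| <= normc z) -> cvgn (series (f \o u)).
  move=> fn; apply: normed_cvg; apply: (@bounded_nneg_cvg _ _ C) => N /=.
    exact: normr_ge0.
  apply: le_trans (uC N); rewrite /series/= big_mkord.
  by apply: ler_sum => i _; exact: fn.
have /cvgrPdist_lt cr := cv _ Re_le_normc.
have /cvgrPdist_lt ci := cv _ Im_le_normc.
set a := lim _ in cr; set b := lim _ in ci.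
exists (a +i* b); apply/cvgcP => e e0.
have e20 : 0 < e / 2 by rewrite divr_gt0.
apply: filterS2 (cr _ e20) (ci _ e20) => n /= h1 h2.
have -> : series u n = (series (@complex.Re R \o u) n) +i* (series (@complex.Im R \o u) n).
  rewrite /series/=; elim: n {h1 h2} => [|n IH]; first by rewrite !big_nil.
  by rewrite !big_nat_recr//= IH; case: (u n).
apply: le_lt_trans (normc_le_ReIm _) _; rewrite [e]splitr.
exact: ltrD.
Qed.

End Modulus.

(** * Majorants and the values of a germ *)

Section Majorants.
Variable R : realType.
Implicit Types (a b : germ R) (r C : R) (w : R[i]).

(** The left-hand side is the part of the double sum of the [x i * y j] below
   the antidiagonal. *)
Lemma sum_cauchy_le (x y : nat -> R) N :
  (forall n, 0 <= x n) -> (forall n, 0 <= y n) ->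
  \sum_(n < N) \sum_(i < n.+1) x i * y (n - i)%N
    <= (\sum_(n < N) x n) * (\sum_(n < N) y n).
Proof.
move=> x0 y0.
elim: N x x0 => [|N IH] x x0; first by rewrite !big_ord0 mul0r.
rewrite [X in _ <= X * _]big_ord_recl mulrDl mulr_sumr.
under eq_bigr do rewrite big_ord_recl subn0.
rewrite big_split/= lerD2l big_ord_recl/= big_ord0 add0r.
have := IH (fun n => x n.+1) (fun n => x0 _).
under [X in X <= _ -> _]eq_bigr do under eq_bigr do rewrite -subSS.
move=> h; apply: le_trans h _; apply: ler_wpM2l; first exact: sumr_ge0.
by rewrite [leRHS]big_ord_recr/= lerDl.
Qed.

(** A bound on the weighted l1 norm [sum |a_n| r^n]: unlike a sup norm, it is
   submultiplicative for the same radius [r] ([majorizedM]). *)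
Definition majorized (r C : R) (a : nat -> R[i]) :=
  forall N, \sum_(n < N) normc (a n) * r ^+ n <= C.

Lemma majorized_germ a : exists r C, 0 < r /\ majorized r C a.
Proof.
have [r r0 ar] := germ_convergent a; exists (r / 2).
have rC : normc (r / 2)%:C = r / 2 by rewrite normcR gtr0_norm// divr_gt0.
have cv : cvgn (series (fun n => normc (a n * (r / 2)%:C ^+ n))).
  by apply: ar; rewrite rC gtr_pMr// invf_lt1// ltr1n.
exists (limn (series (fun n => normc (a n * (r / 2)%:C ^+ n)))).
split=> [|N]; first by rewrite divr_gt0.
have := @nneg_series_le _ _ N (fun n => normc_ge0 _) cv.
rewrite /series/= big_mkord; congr (_ <= _).
by apply: eq_bigr => i _; rewrite normcM normcX rC.
Qed.

Lemma majorizedW r r' C (a : nat -> R[i]) :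
  0 <= r' -> r' <= r -> majorized r C a -> majorized r' C a.
Proof.
move=> r'0 rr aC N; apply: le_trans (aC N); apply: ler_sum => i _.
by apply: ler_wpM2l; rewrite ?normc_ge0// lerXn2r// nnegrE (le_trans r'0).
Qed.

Lemma majorized_ge0 r C (a : nat -> R[i]) : majorized r C a -> 0 <= C.
Proof. by move=> /(_ 0%N); rewrite big_ord0. Qed.

Lemma majorized_convergent r C (a : nat -> R[i]) :
  0 < r -> majorized r C a -> convergent a.
Proof.
move=> r0 aC; exists r => // z zr; apply: (@bounded_nneg_cvg _ _ C) => N.
  exact: normc_ge0.
rewrite /series/= big_mkord; apply: le_trans (aC N); apply: ler_sum => i _.
rewrite normcM normcX ler_wpM2l ?normc_ge0// lerXn2r ?nnegrE ?normc_ge0// ltW//.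
Qed.

Lemma majorizedM r C C' a b : 0 <= r ->
  majorized r C a -> majorized r C' b -> majorized r (C * C') (a * b)%R.
Proof.
move=> r0 aC bC N.
have x0 (c : germ R) n : 0 <= normc (c n) * r ^+ n.
  by rewrite mulr_ge0 ?normc_ge0// exprn_ge0.
apply: le_trans (ler_pM _ _ (aC N) (bC N)); rewrite ?sumr_ge0//.
apply: le_trans (sum_cauchy_le _ (x0 a) (x0 b)); apply: ler_sum => n _.
rewrite -[leRHS](@eq_bigr _ _ _ _ _ _ (fun i : 'I_n.+1 =>
   normc (a i * b (n - i)%N) * r ^+ n)); last first.
  move=> i _; rewrite normcM mulrACA -exprD subnKC// -ltnS//.
rewrite -mulr_suml ler_wpM2r ?exprn_ge0//; exact: normc_le_sum.
Qed.

Section Evaluation.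
Variables (r : R) (w : R[i]).
Hypothesis wr : normc w <= r.

Let r0 : 0 <= r. Proof. exact: le_trans (normc_ge0 _) wr. Qed.

Lemma germ_eval_cvg C a : majorized r C a ->
  series (fun n => a n * w ^+ n) @ \oo --> germ_eval w a.
Proof.
move=> aC; suff [v cv] : exists v : R[i], series (fun n => a n * w ^+ n) @ \oo --> v.
  by rewrite /germ_eval (cvg_lim _ cv).
apply: (@abs_cvgc _ _ C) => N; apply: le_trans (aC N); apply: ler_sum => n _.
by rewrite normcM normcX ler_wpM2l ?normc_ge0// lerXn2r ?nnegrE ?normc_ge0.
Qed.

Lemma germ_eval_le C a : majorized r C a -> normc (germ_eval w a) <= C.
Proof.
move=> aC; apply: cvgc_le (germ_eval_cvg aC) _ => N; apply: le_trans (aC N).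
rewrite /series/= big_mkord; apply: le_trans (normc_le_sum _) _.
apply: ler_sum => n _.
by rewrite normcM normcX ler_wpM2l ?normc_ge0// lerXn2r ?nnegrE ?normc_ge0.
Qed.

Lemma germ_evalD C C' a b : majorized r C a -> majorized r C' b ->
  germ_eval w (a + b) = germ_eval w a + germ_eval w b.
Proof.
move=> /germ_eval_cvg ca /germ_eval_cvg cb.
apply: cvg_lim; first exact: norm_hausdorff.
rewrite (_ : series _ = (series (fun n => a n * w ^+ n) : nat -> R[i])
   + series (fun n => b n * w ^+ n)); first exact: cvgD ca cb.
apply/funext => N; rewrite /series/= fctE/= -big_split/=; apply: eq_bigr => i _.
exact: mulrDl.
Qed.

End Evaluation.

End Majorants.

(** * The variable, the tail, and multiplicativity of evaluation *)

Section Germs.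
Variable R : realType.
Implicit Types (a b c : germ R) (r C : R) (w x : R[i]).

Lemma majorized_const_seq r x : 0 <= r ->
  majorized r (normc x) (fun n => if n == 0%N then x else 0).
Proof.
move=> r0 [|N]; first by rewrite big_ord0 normc_ge0.
by rewrite big_ord_recl/= expr0 mulr1 big1 ?addr0// => i _; rewrite normc0 mul0r.
Qed.

Lemma majorized_var_seq r : 0 <= r -> majorized r r (fun n => (n == 1%N)%:R).
Proof.
move=> r0 [|[|N]]; first by rewrite big_ord0.
  by rewrite big_ord_recl big_ord0 /= normc0 mul0r addr0.
rewrite !big_ord_recl/= normc0 mul0r add0r normc1 mul1r expr1 big1 ?addr0// => i _.
by rewrite ?normc0 mul0r.
Qed.

Definition germ_const x : germ R :=
  mk_germ (majorized_convergent ltr01 (majorized_const_seq x ler01)).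

Definition germ_var : germ R :=
  mk_germ (majorized_convergent ltr01 (majorized_var_seq (@ler01 R))).

Local Notation T := germ_var.

Lemma majorized_tail_seq r C (a : nat -> R[i]) : 0 < r -> majorized r C a ->
  majorized r (C / r) (fun n => a n.+1).
Proof.
move=> r0 aC N; rewrite ler_pdivlMr// mulr_suml; apply: le_trans (aC N.+1).
rewrite big_ord_recl/=; apply: ler_wpDl.
  by rewrite mulr_ge0 ?normc_ge0// exprn_ge0// ltW.
by apply: ler_sum => i _; rewrite -mulrA -exprSr.
Qed.

Lemma tail_convergent a : convergent (fun n => a n.+1).
Proof.
have [r [C [r0 aC]]] := majorized_germ a.
exact: majorized_convergent r0 (majorized_tail_seq r0 aC).
Qed.

(** [(a - a(0)) / t], the other half of the decomposition [germ_tailP].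
   Iterating it gives the estimates by induction below, since each step gains
   a factor [w / r]. *)
Definition germ_tail a : germ R := mk_germ (tail_convergent a).

Lemma majorized_const r x : 0 <= r -> majorized r (normc x) (germ_const x).
Proof. exact: majorized_const_seq. Qed.

Lemma majorized_var r : 0 <= r -> majorized r r germ_var.
Proof. exact: majorized_var_seq. Qed.

Lemma majorized_tail r C a :
  0 < r -> majorized r C a -> majorized r (C / r) (germ_tail a).
Proof. exact: majorized_tail_seq. Qed.

Lemma coef_germD a b n : (a + b)%R n = a n + b n.
Proof. by []. Qed.

Lemma coef_germM a b n : (a * b)%R n = \sum_(i < n.+1) a i * b (n - i)%N.
Proof. by []. Qed.

Lemma coef_germ_constM x a n : (germ_const x * a)%R n = x * a n.
Proof.
rewrite coef_germM big_ord_recl/= subn0 big1 ?addr0// => i _; exact: mul0r.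
Qed.

Lemma coef_germ_varM0 a : (T * a)%R 0%N = 0.
Proof. by rewrite coef_germM big_ord_recl big_ord0/= mul0r addr0. Qed.

Lemma coef_germ_varMS a n : (T * a)%R n.+1 = a n.
Proof.
rewrite coef_germM !big_ord_recl/= mul0r add0r mul1r subSS subn0.
by rewrite big1 ?addr0// => i _; rewrite mul0r.
Qed.

Lemma germ_varMK a b : T * a = T * b -> a = b.
Proof. by move=> ab; apply: germP => n; rewrite -coef_germ_varMS ab coef_germ_varMS. Qed.

Lemma germ_tailP a : a = germ_const (a 0%N) + T * germ_tail a.
Proof.
apply: germP => -[|n]; rewrite coef_germD ?coef_germ_varM0 ?coef_germ_varMS.
  by rewrite /= addr0.
by rewrite /= add0r.
Qed.

(** The value at 0, in a form that is visibly a ring morphism. *)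
Definition germ_at0 (a : germ R) : R[i] := a 0%N.

Lemma germ_at0_zmod_morphism : zmod_morphism germ_at0.
Proof. by []. Qed.

Lemma germ_at0_monoid_morphism : monoid_morphism germ_at0.
Proof.
by split=> // a b; rewrite /germ_at0 coef_germM big_ord_recl big_ord0 addr0.
Qed.

HB.instance Definition _ :=
  GRing.isZmodMorphism.Build (germ R) R[i] germ_at0 germ_at0_zmod_morphism.
HB.instance Definition _ :=
  GRing.isMonoidMorphism.Build (germ R) R[i] germ_at0 germ_at0_monoid_morphism.

Lemma cvgcZ (u : nat -> R[i]) (l x : R[i]) :
  u @ \oo --> l -> (fun n => x * u n) @ \oo --> x * l.
Proof. exact: (@cvgZl_tmp R[i] R[i]^o). Qed.

Lemma germ_eval_const w x : germ_eval w (germ_const x) = x.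
Proof.
apply: (cvg_lim (@norm_hausdorff _ _)); apply: cvg_near_cst.
exists 1%N => // -[//|N] _; rewrite /series/= big_nat_recl//= expr0 mulr1 big1 ?addr0// => i _.
exact: mul0r.
Qed.

Section Evaluation.
Variables (r : R) (w : R[i]).
Hypothesis r0 : 0 < r.
Hypothesis wr : normc w <= r.

Lemma germ_eval_constM C x a : majorized r C a ->
  germ_eval w (germ_const x * a) = x * germ_eval w a.
Proof.
move=> /(germ_eval_cvg wr)/(@cvgcZ _ _ x) ca; apply: (cvg_lim (@norm_hausdorff _ _)).
apply: cvg_trans ca; apply: near_eq_cvg; apply: nearW => N.
rewrite /series mulr_sumr; apply: eq_bigr => i _.
by rewrite coef_germ_constM mulrA.
Qed.

Lemma germ_eval_varM C a : majorized r C a ->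
  germ_eval w (T * a) = w * germ_eval w a.
Proof.
move=> aC; have TC := majorizedM (ltW r0) (majorized_var (ltW r0)) aC.
have /(@cvgcZ _ _ w) ca := germ_eval_cvg wr aC.
apply: cvgc_unique (germ_eval_cvg wr TC) _; rewrite -cvg_shiftS.
apply: cvg_trans ca; apply: near_eq_cvg; apply: nearW => N.
transitivity (series (fun n => (T * a)%R n * w ^+ n) N.+1); last by [].
rewrite /series [LHS]mulr_sumr [RHS]big_nat_recl// coef_germ_varM0 mul0r add0r.
by apply: eq_bigr => i _; rewrite coef_germ_varMS exprS mulrCA.
Qed.

Lemma germ_eval_tail C a : majorized r C a ->
  germ_eval w a = a 0%N + w * germ_eval w (germ_tail a).
Proof.
move=> aC; have tC := majorized_tail r0 aC; have r0' := ltW r0.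
rewrite {1}(germ_tailP a) (germ_evalD wr (majorized_const _ r0')
  (majorizedM r0' (majorized_var r0') tC)).
by rewrite germ_eval_const (germ_eval_varM tC).
Qed.

End Evaluation.

(** The defect [(ab)(w) - a(w) b(w)] is bilinear and vanishes when [a] is a
   constant. Replacing [a] by its tail thus divides the defect by [w], while
   the bounds on it grow by [1 / r] only. Iterating, the defect is at most a
   constant times [(|w| / r)^N] for all [N]. *)
Lemma germ_evalM r C C' w a b : 0 < r -> normc w < r ->
  majorized r C a -> majorized r C' b ->
  germ_eval w (a * b) = germ_eval w a * germ_eval w b.
Proof.
move=> r0 wr aC bC; have wr' := ltW wr; have r0' := ltW r0.
have key N : normc (germ_eval w (a * b) - germ_eval w a * germ_eval w b)
    <= 2 * C * C' * (normc w / r) ^+ N.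
  elim: N a C aC => [|N IH] a C aC.
    rewrite expr0 mulr1; apply: le_trans (normc_le_add _ _) _.
    rewrite normc_opp normcM -mulrA mulr_natl mulr2n lerD//.
      exact: (germ_eval_le wr' (majorizedM r0' aC bC)).
    by apply: ler_pM; rewrite ?normc_ge0// (germ_eval_le wr').
  have tC := majorized_tail r0 aC; pose b' := germ_tail a.
  have kC := majorized_const (a 0%N) r0'; have vC := majorized_var r0'.
  rewrite (germ_eval_tail r0 wr' aC).
  have -> : germ_eval w (a * b) = a 0%N * germ_eval w b + w * germ_eval w (b' * b).
    rewrite {1}(germ_tailP a) mulrDl -mulrA.
    rewrite (germ_evalD wr' (majorizedM r0' kC bC)
      (majorizedM r0' vC (majorizedM r0' tC bC))).
    by rewrite (germ_eval_constM wr' _ bC) (germ_eval_varM r0 wr' (majorizedM r0' tC bC)).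
  rewrite mulrDl opprD addrACA subrr add0r -mulrA -mulrBr normcM.
  apply: le_trans (ler_wpM2l (normc_ge0 w) (IH b' _ tC)) _.
  rewrite exprS le_eqVlt; apply/orP; left; apply/eqP; field.
  by rewrite gt_eqF.
apply/eqP; rewrite -subr_eq0 -normc_eq0; apply/eqP/le_anti.
rewrite normc_ge0 andbT.
have g : `|normc w / r| < 1.
  by rewrite ger0_norm ?ltr_pdivrMr ?mul1r// divr_ge0// normc_ge0.
by apply: (cvgr_to_ge (@cvg_geometric R (2 * C * C') _ g)); apply: nearW.
Qed.

End Germs.

(** * Germs and polynomials over germs at real arguments near 0 *)

Section Near0.
Variable R : realType.
Implicit Types (a b c : germ R) (r C : R) (t : R) (P Q : {poly germ R}).
Local Notation T := (germ_var R).

Lemma germ_eval0 w : germ_eval w (0 : germ R) = 0.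
Proof.
have -> : 0 = germ_const 0 :> germ R by apply: germP => -[].
exact: germ_eval_const.
Qed.

Lemma germ_const1 : germ_const 1 = 1 :> germ R.
Proof. by apply: germP => -[]. Qed.

Lemma germ_eval1 w : germ_eval w (1 : germ R) = 1.
Proof. by rewrite -germ_const1 germ_eval_const. Qed.

Lemma germ_eval_var w : germ_eval w T = w.
Proof.
rewrite -[T]mulr1 -germ_const1.
have r0 : 0 < normc w + 1 by rewrite ltr_wpDl// normc_ge0.
have wr : normc w <= normc w + 1 by rewrite lerDl.
by rewrite (germ_eval_varM r0 wr (majorized_const 1 (ltW r0))) germ_eval_const mulr1.
Qed.

Lemma majorized_common a b : exists r C C',
  [/\ 0 < r, majorized r C a & majorized r C' b].
Proof.
have [r [C [r0 aC]]] := majorized_germ a.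
have [s [C' [s0 bC]]] := majorized_germ b.
have m0 : 0 < Num.min r s by rewrite lt_min r0.
exists (Num.min r s), C, C'; split=> //.
  by apply: (majorizedW _ _ aC); [exact: ltW|rewrite ge_min lexx].
by apply: (majorizedW _ _ bC); [exact: ltW|rewrite ge_min lexx orbT].
Qed.

Lemma near0W (A : R -> Prop) : (forall t, A t) -> \forall t \near (0 : R), A t.
Proof. by move=> h; near do exact: h. Unshelve. all: by end_near. Qed.

Lemma near0_normc r : 0 < r -> \forall t \near (0 : R), normc t%:C < r.
Proof.
by move=> r0; apply: filterS (nbhs0_lt r0) => t; rewrite normcR.
Qed.

Lemma near_germ_evalD a b : \forall t \near (0 : R),
  germ_eval t%:C (a + b) = germ_eval t%:C a + germ_eval t%:C b.
Proof.
have [r [C [C' [r0 aC bC]]]] := majorized_common a b.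
by apply: filterS (near0_normc r0) => t /ltW tr; exact: (germ_evalD tr aC bC).
Qed.

Lemma near_germ_evalM a b : \forall t \near (0 : R),
  germ_eval t%:C (a * b) = germ_eval t%:C a * germ_eval t%:C b.
Proof.
have [r [C [C' [r0 aC bC]]]] := majorized_common a b.
by apply: filterS (near0_normc r0) => t tr; exact: (germ_evalM r0 tr aC bC).
Qed.

Lemma near_germ_evalN a : \forall t \near (0 : R),
  germ_eval t%:C (- a) = - germ_eval t%:C a.
Proof.
apply: filterS (near_germ_evalD a (- a)) => t /eqP.
by rewrite subrr germ_eval0 eq_sym addrC addr_eq0 => /eqP.
Qed.

Lemma near_germ_evalMn a n : \forall t \near (0 : R),
  germ_eval t%:C (a *+ n) = germ_eval t%:C a *+ n.
Proof.
elim: n => [|n IH]; first by apply: near0W => t; rewrite !mulr0n germ_eval0.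
apply: filterS2 IH (near_germ_evalD a (a *+ n)) => t h.
by rewrite -mulrS h -mulrS.
Qed.

Lemma near_germ_evalX a n : \forall t \near (0 : R),
  germ_eval t%:C (a ^+ n) = germ_eval t%:C a ^+ n.
Proof.
elim: n => [|n IH]; first by apply: near0W => t; rewrite !expr0 germ_eval1.
apply: filterS2 IH (near_germ_evalM a (a ^+ n)) => t h.
by rewrite -exprS h -exprS.
Qed.

Lemma germ_eval_bounded a :
  exists C, 0 <= C /\ \forall t \near (0 : R), normc (germ_eval t%:C a) <= C.
Proof.
have [r [C [r0 aC]]] := majorized_germ a; exists C; split; first exact: majorized_ge0 aC.
by apply: filterS (near0_normc r0) => t /ltW tr; exact: (germ_eval_le tr aC).
Qed.

Lemma near_germ_eval_tail a : \forall t \near (0 : R),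
  germ_eval t%:C a = a 0%N + t%:C * germ_eval t%:C (germ_tail a).
Proof.
have [r [C [r0 aC]]] := majorized_germ a.
by apply: filterS (near0_normc r0) => t /ltW tr; exact: (germ_eval_tail r0 tr aC).
Qed.

Lemma germ_eval_at0 a : germ_eval (0 : R)%:C a = a 0%N.
Proof.
by have /= := nbhs_singleton (near_germ_eval_tail a); rewrite mul0r addr0.
Qed.

Lemma germ_eval_lipschitz0 a : exists C, 0 <= C /\
  \forall t \near (0 : R), normc (germ_eval t%:C a - a 0%N) <= C * `|t|.
Proof.
have [C [C0 hC]] := germ_eval_bounded (germ_tail a); exists C; split => //.
apply: filterS2 hC (near_germ_eval_tail a) => t tC ->.
by rewrite addrAC subrr add0r normcM normcR mulrC ler_wpM2r.
Qed.

Lemma germ_eval_near0 a e : 0 < e ->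
  \forall t \near (0 : R), normc (germ_eval t%:C a - a 0%N) < e.
Proof.
move=> e0; have [C [C0 hC]] := germ_eval_lipschitz0 a.
have d0 : 0 < e / (C + 1) by rewrite divr_gt0// ltr_wpDl.
apply: filterS2 hC (near0_normc d0) => t h; rewrite normcR => td.
apply: le_lt_trans h _; apply: (@le_lt_trans _ _ ((C + 1) * `|t|)).
  by rewrite ler_wpM2r// lerDl.
by rewrite mulrC -ltr_pdivlMr// ltr_wpDl.
Qed.

Lemma germ_factor_var a : a 0%N = 0 -> a = T * germ_tail a.
Proof.
move=> a0; rewrite {1}(germ_tailP a) a0.
suff -> : germ_const 0 = 0 :> germ R by rewrite add0r.
by apply: germP => -[].
Qed.

Lemma germ_varXK k a b : T ^+ k * a = T ^+ k * b -> a = b.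
Proof.
by elim: k => [|k IH]; rewrite ?expr0 ?mul1r// exprS -!mulrA => /germ_varMK/IH.
Qed.

Lemma germ_order a : a <> 0 -> exists k b, a = T ^+ k * b /\ b 0%N <> 0.
Proof.
move=> an0; have [n an] : exists n, a n <> 0.
  by apply/not_existsP => h; apply: an0; apply: germP => n; apply: contrapT; exact: h.
elim: n a {an0} an => [|n IH] a an; first by exists 0%N, a; rewrite mul1r.
have [a0|a0] := pselect (a 0%N = 0); last by exists 0%N, a; rewrite mul1r.
have [k [b [ab b0]]] := IH (germ_tail a) an.
by exists k.+1, b; split=> //; rewrite exprS -mulrA -ab; exact: germ_factor_var.
Qed.

(** This turns bounds on values into divisibility; the zoom into a cluster
   rests on it. *)
Lemma germ_dvd_of_growth a k C :
  (\forall t \near 0^', normc (germ_eval t%:C a) <= C * `|t| ^+ k) ->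
  exists b, a = T ^+ k * b.
Proof.
elim: k a => [|k IH] a h; first by exists a; rewrite mul1r.
have a0 : a 0%N = 0.
  apply/eqP; rewrite -normc_eq0 eq_le normc_ge0 andbT; apply/ler_addgt0Pr => e e0.
  rewrite add0r; have e20 : 0 < e / 2 by rewrite divr_gt0.
  have d0 : 0 < e / 2 / (`|C| + 1) by rewrite divr_gt0// ltr_wpDl.
  have h1 := nbhs_dnbhs (germ_eval_near0 a e20).
  have h2 := nbhs_dnbhs (near0_normc d0).
  have h3 := nbhs_dnbhs (near0_normc (@ltr01 R)).
  have [t [[t1 t2] [t3 t4]]] := filter_ex (filterI (filterI h h1) (filterI h2 h3)).
  rewrite normcR in t3 t4; rewrite normcB in t2.
  rewrite -(subrK (germ_eval t%:C a) (a 0%N)); apply: le_trans (normc_le_add _ _) _.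
  rewrite [e]splitr lerD ?(ltW t2)//; apply: le_trans t1 _.
  apply: (@le_trans _ _ ((`|C| + 1) * `|t|)); last first.
    by rewrite mulrC -ler_pdivlMr ?ltW// ltr_wpDl.
  rewrite exprS mulrCA mulrC ler_wpM2r//; apply: (@le_trans _ _ `|C|); last by rewrite lerDl.
  apply: le_trans (ler_norm _) _; rewrite normrM normrX normr_id.
  by rewrite ler_piMr// exprn_ile1// ltW.
have [b ab] : exists b, germ_tail a = T ^+ k * b.
  apply: IH; have tn0 : \forall t \near 0^', t != 0 :> R.
    by rewrite near_withinE; apply: near0W.
  apply: filterS3 h tn0 (nbhs_dnbhs (near_germ_eval_tail a)) => t + tn0 et.
  rewrite et a0 add0r normcM normcR exprS mulrCA ler_pM2l ?normr_gt0//.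
by exists b; rewrite exprS -mulrA -ab; exact: germ_factor_var.
Qed.

(** The identity theorem for germs: a nonzero germ is [t^k b] with [b(0) <>
   0], which cannot be [O(|t|^(k+1))]. *)
Lemma germ_eval_eq0 a : (\forall t \near 0^', germ_eval t%:C a = 0) -> a = 0.
Proof.
move=> h; apply: contrapT => /germ_order[k [b [ab b0]]].
have [|c ac] := @germ_dvd_of_growth a k.+1 0.
  by apply: filterS h => t ->; rewrite normc0 mul0r.
move: ac; rewrite ab exprSr -mulrA => /germ_varXK bc.
by apply: b0; rewrite bc coef_germ_varM0.
Qed.

(** Only real arguments matter, because the hypothesis on the roots concerns
   real arguments only. *)
Definition spec P t := specialize P t%:C.

Lemma coef_spec P t i : (spec P t)`_i = germ_eval t%:C P`_i.
Proof. by apply: coef_map_id0; exact: germ_eval0. Qed.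

Lemma spec_near (A : nat -> R -> Prop) n :
  (forall i, \forall t \near (0 : R), A i t) ->
  \forall t \near (0 : R), forall i, (i < n)%N -> A i t.
Proof.
move=> hA; have : \forall t \near (0 : R), forall i : 'I_n, A i t.
  by apply: (@filter_forall R 'I_n (fun i => A i) (nbhs (0 : R))) => i; exact: hA.
by apply: filterS => t h i ni; exact: (h (Ordinal ni)).
Qed.

Lemma size_spec P t : (size (spec P t) <= size P)%N.
Proof. exact: size_poly. Qed.

Lemma near_specD P Q : \forall t \near (0 : R), spec (P + Q) t = spec P t + spec Q t.
Proof.
have := spec_near (maxn (size P) (size Q)) (fun i => near_germ_evalD P`_i Q`_i).
apply: filterS => t h; apply/polyP => i; rewrite coefD !coef_spec coefD.
have [/h//|] := ltnP i (maxn (size P) (size Q)).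
rewrite geq_max => /andP[iP iQ].
by rewrite (nth_default _ iP) (nth_default _ iQ) addr0 germ_eval0 addr0.
Qed.

Lemma near_specZ a P : \forall t \near (0 : R), spec (a *: P) t = germ_eval t%:C a *: spec P t.
Proof.
have := spec_near (size P) (fun i => near_germ_evalM a P`_i).
apply: filterS => t h; apply/polyP => i; rewrite coefZ !coef_spec coefZ.
have [/h//|iP] := ltnP i (size P).
by rewrite (nth_default _ iP) mulr0 germ_eval0 mulr0.
Qed.

Lemma specC a t : spec a%:P t = (germ_eval t%:C a)%:P.
Proof.
by apply/polyP => i; rewrite coef_spec !coefC; case: ifP => // _; exact: germ_eval0.
Qed.

Lemma specMX P t : spec (P * 'X) t = spec P t * 'X.
Proof.
apply/polyP => i; rewrite coef_spec !coefMX coef_spec; case: ifP => // _.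
exact: germ_eval0.
Qed.

(** As multiplicativity of evaluation holds on a disc that depends on the
   germs, it holds for polynomials over germs near 0 only. The same applies to
   the other lemmas of this form. *)
Lemma near_specM P Q : \forall t \near (0 : R), spec (P * Q) t = spec P t * spec Q t.
Proof.
elim/poly_ind: P => [|P a IH].
  apply: near0W => t; rewrite mul0r.
  by have -> : spec 0 t = 0; [rewrite -polyC0 specC germ_eval0|rewrite mul0r].
rewrite mulrDl mulrAC mul_polyC.
apply: filterS3 (near_specD (P * Q * 'X) (a *: Q)) (near_specZ a Q)
  (filterI IH (near_specD (P * 'X) a%:P)) => t -> -> [h ->].
by rewrite !specMX h specC mulrDl mul_polyC mulrAC.
Qed.

Lemma near_spec_comp P Q : \forall t \near (0 : R), spec (P \Po Q) t = spec P t \Po spec Q t.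
Proof.
elim/poly_ind: P => [|P a IH].
  apply: near0W => t; rewrite comp_poly0.
  by have -> : spec 0 t = 0; [rewrite -polyC0 specC germ_eval0|rewrite comp_poly0].
rewrite comp_poly_MXaddC.
apply: filterS3 (near_specD ((P \Po Q) * Q) a%:P) (near_specM (P \Po Q) Q)
  (filterI IH (near_specD (P * 'X) a%:P)) => t -> -> [-> ->].
by rewrite !specMX !specC comp_poly_MXaddC.
Qed.

Lemma near_spec_XsubC a : \forall t \near (0 : R),
  spec ('X - a%:P) t = 'X - (germ_eval t%:C a)%:P.
Proof.
rewrite -polyCN -[X in X + _]mul1r.
apply: filterS2 (near_specD (1 * 'X) (- a)%:P) (near_germ_evalN a) => t -> h.
by rewrite specMX !specC h germ_eval1 mul1r polyCN.
Qed.

Lemma near_spec_prod (s : seq (germ R)) : \forall t \near (0 : R),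
  spec (\prod_(a <- s) ('X - a%:P)) t = \prod_(a <- s) ('X - (germ_eval t%:C a)%:P).
Proof.
elim: s => [|a s IH].
  by apply: near0W => t; rewrite !big_nil -polyC1 specC germ_eval1.
rewrite big_cons.
apply: filterS3 (near_specM ('X - a%:P) (\prod_(a <- s) ('X - a%:P)))
   (near_spec_XsubC a) IH => t -> -> ->.
by rewrite big_cons.
Qed.

Lemma spec_monic P t : P \is monic -> spec P t \is monic /\ size (spec P t) = size P.
Proof.
move=> Pm; have sP : size (spec P t) = size P.
  apply: size_poly_eq; rewrite -[_`_ _]/(lead_coef P) (monicP Pm) germ_eval1.
  exact: oner_neq0.
split=> //; apply/monicP; rewrite /lead_coef sP coef_spec.
by rewrite -[P`_ _]/(lead_coef P) (monicP Pm) germ_eval1.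
Qed.

End Near0.

(** * Hensel's lemma for convergent power series *)

(** The [n]-th value of the iterates of [F] does not change from the [n.+1]-st
   iterate on. *)
Lemma course_of_values (A : Type) (F : nat -> (nat -> A) -> A) :
  (forall n f g, (forall i, (i < n)%N -> f i = g i) -> F n f = F n g) -> A ->
  exists f, forall n, f n = F n f.
Proof.
move=> Fext x0; pose g k := iter k (fun f n => F n f) (fun=> x0).
have gE n k m : (n < k)%N -> (n < m)%N -> g k n = g m n.
  elim/ltn_ind: n k m => n IH [//|k] [//|m] nk nm /=.
  by apply: Fext => i ni; apply: IH; rewrite ?(leq_trans ni).
exists (fun n => g n.+1 n) => n; apply: (Fext n (g n)) => i ni.
by apply: gE.
Qed.

Section Majorant.
Variable R : realType.

(** The partial sums [S_N] of [x_n r^n] satisfy [S_(N+1) <= m + K S_N^2],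
   where [m] bounds the contribution of [p] and is as small as desired when
   [r] is small, since [p] enters with index at least 1. If [4 K m <= 1], then
   [S_N <= 2 m] is preserved: [m + K (2 m)^2 <= 2 m]. *)
Lemma quadratic_majorant (x p : nat -> R) (K rho C : R) :
  (forall n, 0 <= x n) -> (forall n, 0 <= p n) -> x 0%N = 0 -> 0 < K -> 0 < rho ->
  (forall n, (0 < n)%N -> x n <= K * (p n + \sum_(i < n.+1) x i * x (n - i)%N)) ->
  (forall N, \sum_(n < N) p n * rho ^+ n <= C) ->
  exists r C', 0 < r /\ forall N, \sum_(n < N) x n * r ^+ n <= C'.
Proof.
move=> x0 p0 x00 K0 rho0 xK pC.
have C0 : 0 <= C by have := pC 0%N; rewrite big_ord0.
(* The second bound is chosen for [4 * K * m <= 1] below. *)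
pose r := Num.min rho (rho / (4 * K ^+ 2 * (C + 1))).
have Kpos : 0 < 4 * K ^+ 2 * (C + 1).
  by rewrite mulr_gt0// ?ltr_wpDl// mulr_gt0// exprn_gt0.
have r0 : 0 < r by rewrite lt_min rho0 divr_gt0.
pose m := K * (C * (r / rho)).
have Km : 4 * K * m <= 1.
  rewrite /m; have rle : r <= rho / (4 * K ^+ 2 * (C + 1)) by rewrite ge_min lexx orbT.
  have rr : r / rho <= (4 * K ^+ 2 * (C + 1))^-1.
    by rewrite ler_pdivrMr// mulrC.
  have -> : 4 * K * (K * (C * (r / rho))) = (4 * K ^+ 2 * C) * (r / rho) by ring.
  apply: le_trans (ler_wpM2l _ rr) _; first by rewrite !mulr_ge0// ltW.
  rewrite ler_pdivrMr// mul1r ler_wpM2l ?lerDl//.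
  by rewrite mulr_ge0// exprn_ge0// ltW.
have m0 : 0 <= m by rewrite !mulr_ge0// ?invr_ge0 ltW.
have pm N : K * \sum_(n < N) p n.+1 * r ^+ n.+1 <= m.
  apply: ler_wpM2l; first exact: ltW.
  apply: (@le_trans _ _ ((\sum_(n < N) p n.+1 * rho ^+ n.+1) * (r / rho))); last first.
    apply: ler_wpM2r; first by rewrite divr_ge0// ltW.
    apply: le_trans (pC N.+1); rewrite big_ord_recl/= lerDr expr0 mulr1//.
  rewrite mulr_suml; apply: ler_sum => n _; rewrite -mulrA ler_wpM2l//.
  have -> : r ^+ n.+1 = r * r ^+ n by rewrite exprS.
  have -> : rho ^+ n.+1 * (r / rho) = r * rho ^+ n.
    by rewrite exprS; field; rewrite gt_eqF.
  rewrite ler_wpM2l ?(ltW r0)// lerXn2r ?nnegrE ?(ltW r0) ?(ltW rho0)//.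
  by rewrite ge_min lexx.
exists r, (2 * m); split=> //; elim=> [|N IH]; first by rewrite big_ord0 mulr_ge0.
(* The terms of index 0 and [n.+1] of the convolution vanish, so that only the
   terms of index below [N] contribute: [y] is the truncated sequence. *)
pose y n := if (n < N)%N then x n * r ^+ n else 0.
have y0 n : 0 <= y n by rewrite /y; case: ifP => // _; rewrite mulr_ge0// exprn_ge0// ltW.
have yS : \sum_(n < N.+1) y n = \sum_(n < N) x n * r ^+ n.
  rewrite big_ord_recr/= {2}/y ltnn addr0; apply: eq_bigr => i _.
  by rewrite /y ltn_ord.
rewrite big_ord_recl/= x00 mul0r add0r.
have step (n : 'I_N) : x n.+1 * r ^+ n.+1 <=
    K * (p n.+1 * r ^+ n.+1) + K * \sum_(i < n.+2) y i * y (n.+1 - i)%N.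
  rewrite -mulrDr; apply: le_trans (ler_wpM2r _ (xK n.+1 isT)) _.
    by rewrite exprn_ge0// ltW.
  rewrite -mulrA mulrDl ler_wpM2l ?(ltW K0)// lerD2l mulr_suml.
  apply: ler_sum => i _; have [->|i0] := posnP i; first by rewrite x00 !mul0r mulr_ge0.
  have [iN|iN] := ltnP i N; last first.
    have -> : i = n.+1 :> nat.
      by apply/eqP; rewrite eqn_leq -ltnS ltn_ord/= (leq_trans _ iN).
    by rewrite subnn x00 mulr0 mul0r mulr_ge0.
  have niN : (n.+1 - i < N)%N.
    by apply: leq_ltn_trans (ltn_ord n); rewrite leq_subLR; exact: (leq_add i0 (leqnn n)).
  by rewrite /y iN niN mulrACA -exprD subnKC// -ltnS.
apply: le_trans (ler_sum _ (fun i _ => step i)) _.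
rewrite big_split/= -!mulr_sumr.
apply: (@le_trans _ _ (m + K * (2 * m) ^+ 2)).
  apply: lerD; first exact: pm.
  rewrite ler_wpM2l ?(ltW K0)//.
  have := sum_cauchy_le N.+1 y0 y0; rewrite big_ord_recl/= -expr2 => h.
  apply: (@le_trans _ _ ((\sum_(n < N.+1) y n) ^+ 2)).
    by apply: le_trans h; rewrite lerDr big_ord_recl big_ord0 addr0 mulr_ge0.
  have S0 : 0 <= \sum_(n < N.+1) y n by exact: sumr_ge0.
  rewrite yS; rewrite yS in S0.
  by rewrite ler_sqr// nnegrE// mulr_ge0.
have -> : m + K * (2 * m) ^+ 2 = m + (4 * K * m) * m by ring.
have -> : 2 * m = m + 1 * m by ring.
by rewrite lerD2l ler_wpM2r.
Qed.

End Majorant.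

Section Norm1.
Variable R : realType.
Implicit Types p q : {poly R[i]}.

(** The sum stops at a fixed [D] for all polynomials, so that the norm is
   submultiplicative and subadditive without conditions on degrees. *)
Definition norm1 D p : R := \sum_(i < D) normc p`_i.

Lemma norm1_ge0 D p : 0 <= norm1 D p.
Proof. by apply: sumr_ge0 => i _; exact: normc_ge0. Qed.

Lemma norm1D D p q : norm1 D (p + q) <= norm1 D p + norm1 D q.
Proof.
rewrite /norm1 -big_split/=; apply: ler_sum => i _; rewrite coefD.
exact: normc_le_add.
Qed.

Lemma norm1N D p : norm1 D (- p) = norm1 D p.
Proof. by apply: eq_bigr => i _; rewrite coefN normc_opp. Qed.

Lemma norm1_sum D n (F : 'I_n -> {poly R[i]}) :
  norm1 D (\sum_(i < n) F i) <= \sum_(i < n) norm1 D (F i).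
Proof.
elim/big_ind2 : _ => [|x u y v xu yv|//].
  by rewrite /norm1 big1// => i _; rewrite coef0 normc0.
by apply: le_trans (norm1D _ _ _) _; exact: lerD.
Qed.

Lemma norm1Z D c p : norm1 D (c *: p) = normc c * norm1 D p.
Proof. by rewrite /norm1 mulr_sumr; apply: eq_bigr => i _; rewrite coefZ normcM. Qed.

Lemma norm1M D p q : norm1 D (p * q) <= norm1 D p * norm1 D q.
Proof.
apply: le_trans (sum_cauchy_le D (fun i => normc_ge0 p`_i) (fun i => normc_ge0 q`_i)).
apply: ler_sum => i _; rewrite coefM; apply: le_trans (normc_le_sum _) _.
by apply: ler_sum => j _; rewrite normcM.
Qed.

Lemma normc_coef_le_norm1 D p i : (i < D)%N -> normc p`_i <= norm1 D p.
Proof.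
move=> iD; rewrite /norm1 (bigD1 (Ordinal iD))//= lerDl.
by apply: sumr_ge0 => j _; exact: normc_ge0.
Qed.

(** A linear map on polynomials of bounded degree is determined by its values
   on the monomials. *)
Lemma norm1_linear_bounded D (f : {poly R[i]} -> {poly R[i]}) :
  (forall p q, f (p + q) = f p + f q) -> (forall c p, f (c *: p) = c *: f p) ->
  exists K, 0 <= K /\
    forall p, (size p <= D)%N -> norm1 D (f p) <= K * norm1 D p.
Proof.
move=> fD fZ; exists (\sum_(i < D) norm1 D (f 'X^i)); split.
  by apply: sumr_ge0 => i _; exact: norm1_ge0.
have f0 : f 0 = 0 by rewrite -(scale0r (0 : {poly R[i]})) fZ !scale0r.
move=> p pD; have pE : p = \sum_(i < D) p`_i *: 'X^i.
  rewrite -poly_def; apply/polyP => i; rewrite coef_poly.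
  by case: ltnP => // Di; rewrite nth_default// (leq_trans pD).
have fE : f p = \sum_(i < D) p`_i *: f 'X^i.
  rewrite [in LHS]pE (big_morph f fD f0); apply: eq_bigr => i _.
  exact: fZ.
rewrite fE; apply: le_trans (norm1_sum _ _) _; rewrite mulr_suml.
apply: ler_sum => i _; rewrite norm1Z mulrC ler_wpM2l ?norm1_ge0//.
exact: normc_coef_le_norm1.
Qed.

End Norm1.

Section Hensel.
Variable R : realType.
Implicit Types (P : {poly germ R}) (p q s E : {poly R[i]}).

(** The coefficient of [t^n] in [P], a polynomial over the complex numbers:
   [P] is the series of the [slice P n * t^n]. *)
Definition slice P n : {poly R[i]} := \poly_(i < size P) (P`_i n).

Lemma coef_slice P n i : (slice P n)`_i = P`_i n.
Proof. by rewrite coef_poly; case: ltnP => // h; rewrite nth_default. Qed.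

Lemma size_slice_monic P n : P \is monic -> (0 < n)%N ->
  (size (slice P n) <= (size P).-1)%N.
Proof.
move=> Pm n0; apply/leq_sizeP => j; rewrite leq_eqVlt => /orP[/eqP <-|h].
  by rewrite coef_slice -[P`_ _]/(lead_coef P) (monicP Pm) /= /ps_one; case: n n0.
by rewrite coef_slice nth_default//; move: h; case: (size P).
Qed.

Lemma majorized_seq (a : nat -> germ R) D : exists rho C, 0 < rho /\
  forall N, \sum_(n < N) (\sum_(j < D) normc (a j n)) * rho ^+ n <= C.
Proof.
elim: D => [|D [r [C [r0 rC]]]].
  exists 1, 0; split=> // N.
  by rewrite big1// => n _; rewrite big_ord0 mul0r.
have [s [C' [s0 sC]]] := majorized_germ (a D).
have m0 : 0 < Num.min r s by rewrite lt_min r0.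
exists (Num.min r s), (C + C'); split=> // N.
under eq_bigr do rewrite big_ord_recr/= mulrDl.
rewrite big_split/=; apply: lerD; last first.
  by apply: (majorizedW _ _ sC); [exact: ltW|rewrite ge_min lexx orbT].
apply: le_trans (rC N); apply: ler_sum => n _; apply: ler_wpM2l.
  by apply: sumr_ge0 => i _; exact: normc_ge0.
by rewrite lerXn2r ?nnegrE ?(ltW r0) ?(ltW m0)// ge_min lexx.
Qed.

(** The solution of [A s + B q = E] with [deg A < deg q] and [deg B < deg s]
   is linear in [E], which makes it bounded. *)
Lemma bezout_solve q s : q \is monic -> s \is monic -> coprimep q s ->
  exists phi psi : {poly R[i]} -> {poly R[i]},
  [/\ (forall E, (size E < size q + size s - 1)%N ->
         [/\ phi E * s + psi E * q = E, (size (phi E) < size q)%N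
           & (size (psi E) < size s)%N]),
      (forall E F, phi (E + F) = phi E + phi F) /\
        (forall c E, phi (c *: E) = c *: phi E)
    & (forall E F, psi (E + F) = psi E + psi F) /\
        (forall c E, psi (c *: E) = c *: psi E)].
Proof.
move=> qm sm /Bezout_coprimepP[[u v] /= uv].
(* The gcd is only known up to a nonzero constant factor. *)
have [k k0 uvk] : exists2 k, k != 0 & u * q + v * s = k%:P.
  have := uv; rewrite -size_poly_eq1 => /size_poly1P[k k0 ->]; by exists k.
pose phi E := ((k^-1 *: E) * v) %% q; pose psi E := (E - phi E * s) %/ q.
have phiD E F : phi (E + F) = phi E + phi F.
  by rewrite /phi scalerDr mulrDl modpD.
have phiZ c E : phi (c *: E) = c *: phi E.
  by rewrite /phi scalerA (mulrC _ c) -scalerA -scalerAl modpZl.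
exists phi, psi; split=> //; last first.
  split=> [E F|c E]; rewrite /psi ?phiD ?phiZ.
    by rewrite -divpD mulrDl opprD addrACA.
  by rewrite -divpZl -scalerAl scalerBr.
move=> E sE.
have q0 : q != 0 by exact: monic_neq0.
have s0 : s != 0 by exact: monic_neq0.
have qdvd : q %| E - phi E * s.
  suff -> : E - phi E * s = ((k^-1 *: E) * u + ((k^-1 *: E) * v) %/ q * s) * q.
    exact: dvdp_mulIr.
  have EE : E = (k^-1 *: E) * (u * q + v * s).
    by rewrite uvk mulrC mul_polyC scalerA mulfV// scale1r.
  have := divp_eq ((k^-1 *: E) * v) q; rewrite -/(phi E) => vE.
  rewrite {1}EE mulrDr [in LHS](mulrA _ v) {1}vE !mulrDl; ring.
have sphi : (size (phi E) < size q)%N by rewrite ltn_modp.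
split=> //; first by rewrite divpK// addrC subrK.
have szq : (0 < size q)%N by rewrite size_poly_gt0.
have szs : (0 < size s)%N by rewrite size_poly_gt0.
rewrite size_divp// -ltnS.
have : (size (E - phi E * s)%R < size q + size s - 1)%N.
  apply: leq_ltn_trans (size_polyD _ _) _; rewrite size_polyN gtn_max sE/=.
  apply: leq_ltn_trans (size_polyMleq _ _) _.
  by move: sphi szq szs; move: (size (phi E)) (size q) (size s) => a b c; lia.
have arith (a b c : nat) : (0 < b -> 0 < c -> a < b + c - 1 ->
  (a - b.-1).+1 < c.+1)%N by lia.
exact: arith.
Qed.

(** The slices of the two factors are found one after the other: those of
   order [n] solve a Bezout equation whose right-hand side [E n] involves the
   previous ones. Since the solution is bounded linearly by [E n], the norms
   of the slices satisfy the recursion of [quadratic_majorant], hence the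
   factors converge. *)
Lemma hensel P q s : P \is monic -> q \is monic -> s \is monic ->
  coprimep q s -> map_poly (@germ_at0 R) P = q * s ->
  exists Q S : {poly germ R}, [/\ Q \is monic, S \is monic,
    size Q = size q, size S = size s & P = Q * S].
Proof.
move=> Pm qm sm qs Pqs.
have szq : (0 < size q)%N by rewrite size_poly_gt0 monic_neq0.
have szs : (0 < size s)%N by rewrite size_poly_gt0 monic_neq0.
have sizeP : size P = (size q + size s - 1)%N.
  have <- : size (map_poly (@germ_at0 R) P) = size P.
    apply: size_poly_eq; rewrite -[_`_ _]/(lead_coef P) (monicP Pm).
    exact: oner_neq0.
  by rewrite Pqs size_monicM ?monic_neq0// subn1.
have slice0 : slice P 0 = q * s.
  by rewrite -Pqs; apply/polyP => i; rewrite coef_slice.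
have [phi [psi [sol [phiD phiZ] [psiD psiZ]]]] := bezout_solve qm sm qs.
pose E n (X : nat -> {poly R[i]} * {poly R[i]}) :=
  slice P n - \sum_(i < n | (0 < i)%N) (X i).1 * (X (n - i)%N).2.
pose F n X := if n == 0%N then (q, s) else (phi (E n X), psi (E n X)).
have [X XF] : exists X, forall n, X n = F n X.
  apply: (course_of_values _ (q, s)) => n f g fg; rewrite /F; case: ifP => // n0.
  suff -> : E n f = E n g by [].
  rewrite /E; congr (_ - _); apply: eq_bigr => i i0; rewrite !fg//.
  by rewrite ltn_subrL i0 lt0n n0.
have X0 : X 0%N = (q, s) by rewrite XF.
have XE n : X n.+1 = (phi (E n.+1 X), psi (E n.+1 X)) by rewrite XF.
have XS n : [/\ (X n.+1).1 * s + (X n.+1).2 * q = E n.+1 X,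
    (size (X n.+1).1 < size q)%N & (size (X n.+1).2 < size s)%N].
  elim/ltn_ind: n => n IH; rewrite XE /=; apply: sol.
  apply: (@leq_ltn_trans (size P).-1); last by rewrite sizeP; lia.
  apply: leq_trans (size_polyD _ _) _; rewrite size_polyN geq_max.
  rewrite size_slice_monic//=; apply: leq_trans (size_sum _ _ _) _.
  apply/bigmax_leqP => -[[|i] /= ni] // _.
  have [_ h1 _] := IH _ (ni : (i < n)%N).
  have ni' : (n.+1 - i.+1 = (n - i.+1).+1)%N by rewrite subSS; lia.
  have ni2 : (n - i.+1 < n)%N by lia.
  have [_ _ h2] := IH _ ni2; rewrite ni'.
  have arith (a b c d : nat) : (a < c -> b < d -> (a + b).-1 <= (c + d - 1).-1)%N.
    by clear; lia.
  by rewrite sizeP; apply: leq_trans (size_polyMleq _ _) _; exact: arith h1 h2.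
(* The recursion says exactly that the Cauchy product of the two factors is
   [P]. *)
have conv n : \sum_(i < n.+1) (X i).1 * (X (n - i)%N).2 = slice P n.
  case: n => [|n]; first by rewrite big_ord_recl big_ord0 subn0 X0 addr0 slice0.
  have [h _ _] := XS n.
  rewrite big_ord_recr/= subnn X0/= (bigD1 ord0)//= subn0 X0/= -/(E _ _).
  have -> : \sum_(i < n.+1 | i != ord0) (X i).1 * (X (n.+1 - i)%N).2 =
     slice P n.+1 - E n.+1 X.
    rewrite /E opprB addrC subrK; apply: eq_bigl => i.
    by rewrite lt0n.
  rewrite -h; ring.
have [K [K0 Kphi]] := norm1_linear_bounded (size P) phiD phiZ.
have [L [L0 Lpsi]] := norm1_linear_bounded (size P) psiD psiZ.
pose D := size P.
(* The initial factors are left out, as [E] does not involve them and the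
   majorant needs a sequence that vanishes at 0. *)
pose x n := if n == 0%N then 0 else norm1 D (X n).1 + norm1 D (X n).2.
have x0 n : 0 <= x n by rewrite /x; case: ifP => // _; rewrite addr_ge0 ?norm1_ge0.
have [r [C [r0 xC]]] : exists r C, 0 < r /\ forall N, \sum_(n < N) x n * r ^+ n <= C.
  have [rho [C [rho0 PC]]] : exists rho C, 0 < rho /\
      forall N, \sum_(n < N) norm1 D (slice P n) * rho ^+ n <= C.
    have [rho [C [rho0 PC]]] := majorized_seq (fun j => P`_j) D.
    exists rho, C; split=> // N; apply: le_trans (PC N); apply: ler_sum => n _.
    by rewrite /norm1; under eq_bigr do rewrite coef_slice.
  apply: (@quadratic_majorant _ x (fun n => norm1 D (slice P n)) (K + L + 1) rho C) => //.
  - by move=> n; exact: norm1_ge0.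
  - by rewrite ltr_wpDl// addr_ge0.
  case=> // n _.
  have En : norm1 D (E n.+1 X) <= norm1 D (slice P n.+1) +
      \sum_(i < n.+2) x i * x (n.+1 - i)%N.
    rewrite /E; apply: le_trans (norm1D _ _ _) _; rewrite norm1N lerD2l.
    rewrite big_mkcond/=; apply: le_trans (norm1_sum _ _) _.
    rewrite [leRHS]big_ord_recr/= ler_wpDr ?mulr_ge0//; apply: ler_sum => i _.
    case: ifPn => [i0|_]; last first.
      by rewrite /norm1 big1 ?mulr_ge0// => k _; rewrite coef0 normc0.
    have xE k : (0 < k)%N -> x k = norm1 D (X k).1 + norm1 D (X k).2.
      by rewrite /x; case: k.
    apply: le_trans (norm1M _ _ _) _; rewrite !xE ?subn_gt0//.
    by apply: ler_pM; rewrite ?norm1_ge0// ?lerDl ?lerDr norm1_ge0.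
  have sE : (size (E n.+1 X) <= size P)%N.
    have [<- h1 h2] := XS n; apply: leq_trans (size_polyD _ _) _.
    have arith (a b c d : nat) : (0 < a -> 0 < b -> c < a -> d < b ->
      (c + b).-1 <= a + b - 1)%N /\ (0 < a -> 0 < b -> c < a -> d < b ->
      (d + a).-1 <= a + b - 1)%N by clear; split; lia.
    rewrite geq_max sizeP; apply/andP; split; apply: leq_trans (size_polyMleq _ _) _.
      exact: (arith _ _ _ _).1 szq szs h1 h2.
    exact: (arith _ _ _ _).2 szq szs h1 h2.
  rewrite {1}/x /= XE /=; apply: (@le_trans _ _ ((K + L + 1) * norm1 D (E n.+1 X))).
    rewrite -addrA mulrDl mulrDl addrA ler_wpDr ?lerD//.
    + by rewrite mul1r norm1_ge0.
    + exact: Kphi.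
    + exact: Lpsi.
  by rewrite ler_wpM2l// !addr_ge0.
have cv (f : nat -> {poly R[i]}) j : (forall n, normc (f n.+1)`_j <= x n.+1) ->
    convergent (fun n => (f n)`_j).
  move=> fx; apply: (@majorized_convergent _ r (C + normc (f 0%N)`_j)) => // -[|N].
    by rewrite big_ord0 addr_ge0 ?normc_ge0//; have := xC 0%N; rewrite big_ord0.
  rewrite big_ord_recl expr0 mulr1 addrC lerD2r; apply: le_trans (xC N.+1).
  rewrite [leRHS]big_ord_recl/= mul0r add0r; apply: ler_sum => i _.
  by rewrite ler_wpM2r ?fx// exprn_ge0// ltW.
have sz1 n : (size (X n).1 <= size q)%N.
  by case: n => [|n]; rewrite ?X0//; have [_ /ltnW] := XS n.
have sz2 n : (size (X n).2 <= size s)%N.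
  by case: n => [|n]; rewrite ?X0//; have [_ _ /ltnW] := XS n.
have qD : (size q <= D)%N by rewrite /D sizeP; lia.
have sD : (size s <= D)%N by rewrite /D sizeP; lia.
have cv1 j : convergent (fun n => ((X n).1)`_j).
  apply: (cv (fun n => (X n).1)) => n; have [jD|Dj] := ltnP j D.
    apply: le_trans (normc_coef_le_norm1 _ jD) _.
    by rewrite /x /= lerDl norm1_ge0.
  by rewrite nth_default ?normc0// (leq_trans (sz1 _))// (leq_trans qD).
have cv2 j : convergent (fun n => ((X n).2)`_j).
  apply: (cv (fun n => (X n).2)) => n; have [jD|Dj] := ltnP j D.
    apply: le_trans (normc_coef_le_norm1 _ jD) _.
    by rewrite /x /= lerDr norm1_ge0.
  by rewrite nth_default ?normc0// (leq_trans (sz2 _))// (leq_trans sD).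
pose Q := \poly_(j < size q) mk_germ (cv1 j).
pose S := \poly_(j < size s) mk_germ (cv2 j).
have QE j n : Q`_j n = ((X n).1)`_j.
  rewrite coef_poly; case: ltnP => // h.
  by rewrite nth_default// (leq_trans (sz1 n)).
have SE j n : S`_j n = ((X n).2)`_j.
  rewrite coef_poly; case: ltnP => // h.
  by rewrite nth_default// (leq_trans (sz2 n)).
have lc (U : {poly germ R}) (u : {poly R[i]}) (f : nat -> {poly R[i]}) :
    (size U <= size u)%N -> u \is monic -> (forall j n, U`_j n = (f n)`_j) ->
    f 0%N = u -> (forall n, (size (f n.+1) < size u)%N) ->
    U \is monic /\ size U = size u.
  move=> sU um Uf f0 fS.
  have U1 : U`_(size u).-1 = 1.
    apply: germP => -[|n]; rewrite Uf ?f0.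
      by rewrite -[u`__]/(lead_coef u) (monicP um).
    by rewrite nth_default// -ltnS prednK// size_poly_gt0 monic_neq0.
  have su : size U = size u.
    apply/eqP; rewrite eqn_leq sU/= leqNgt; apply/negP => h.
    have /eqP := U1; rewrite nth_default ?(eq_sym 0) ?oner_eq0// 1?eq_sym ?oner_eq0//.
    by rewrite -ltnS prednK// size_poly_gt0 monic_neq0.
  by split=> //; apply/monicP; rewrite /lead_coef su.
have [Qm sQ] : Q \is monic /\ size Q = size q.
  apply: (lc Q q (fun n => (X n).1)) => //; first exact: size_poly.
    by rewrite X0.
  by move=> n; have [] := XS n.
have [Sm sS] : S \is monic /\ size S = size s.
  apply: (lc S s (fun n => (X n).2)) => //; first exact: size_poly.
    by rewrite X0.
  by move=> n; have [] := XS n.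
exists Q, S; split=> //; apply/polyP => k; apply: germP => n.
rewrite -coef_slice -conv coef_sum coefM.
rewrite (big_morph (fun a : germ R => a n) (id1 := 0) (op1 := +%R))//.
under [RHS]eq_bigr do rewrite coef_germM.
rewrite exchange_big/=; apply: eq_bigr => i _; rewrite coefM.
by apply: eq_bigr => j _; rewrite QE SE.
Qed.

End Hensel.

(** * Secants of an analytic curve *)

Section Curves.
Variable R : realType.
Implicit Types (a b c : germ R) (r C : R) (t x y : R) (P Q : {poly germ R}).
Local Notation T := (germ_var R).

(** If [kappa = k tau^(-2)] with [k > 1] and [|tau| = 1], the inequality says
   that [w] lies in a double cone around the line of direction [tau]. The
   condition is real-homogeneous and quadratic in [w], so it can be summed
   over pairs of roots to give an inequality between symmetric functions. *)
Definition cone (kappa w : R[i]) : Prop := normc w ^+ 2 <= complex.Re (kappa * w ^+ 2).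

(** The terms at [z] are bounded, so the series converges absolutely in the
   disc of radius [|z| / 2]. *)
Lemma pointwise_cvg_convergent (c : nat -> R[i]) (z v : R[i]) :
  z != 0 -> series (fun n => c n * z ^+ n) @ \oo --> v -> convergent c.
Proof.
move=> z0 cv.
have /cvgcP t0 : (fun n => c n * z ^+ n) @ \oo --> 0.
  by apply: cvg_series_cvg_0; apply/cvg_ex; exists v.
have nz0 : 0 < normc z by rewrite normc_gt0.
have : (fun n => normc (c n * z ^+ n)) @ \oo --> 0.
  apply/cvgrPdist_lt => e e0; apply: filterS (t0 e e0) => n.
  by rewrite !sub0r !normrN normc_opp ger0_norm// normc_ge0.
move=> /cvgP/cvg_seq_bounded/pinfty_ex_gt0[M M0 hM].
apply: (@majorized_convergent _ (normc z / 2) (M * 2)); first by rewrite divr_gt0.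
move=> N; apply: (@le_trans _ _ (\sum_(n < N) M * 2^-1 ^+ n)).
  apply: ler_sum => n _; rewrite expr_div_n -exprVn mulrA ler_wpM2r ?exprn_ge0//.
  by rewrite -normcX -normcM; have /= := hM n I; rewrite ger0_norm// normc_ge0.
rewrite -mulr_sumr ler_wpM2l ?(ltW M0)//.
have -> : \sum_(n < N) 2^-1 ^+ n = 2 - 2 * 2^-1 ^+ N :> R.
  elim: N => [|N IH]; first by rewrite big_ord0 expr0; lra.
  by rewrite big_ord_recr/= IH exprS; field.
by rewrite gerBl mulr_ge0// exprn_ge0.
Qed.

(** By [germ_eval_tail], the difference of the values of [a] is [(w - z) a'(w)
   + z (a'(w) - a'(z))] with [a'] the tail of [a]. Iterating, the second term
   is halved each time as [|z| <= r / 2]. *)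
Lemma germ_eval_lipschitz r C w z a : 0 < r -> majorized r C a ->
  normc w <= r / 2 -> normc z <= r / 2 ->
  normc (germ_eval w a - germ_eval z a) <= normc (w - z) * (2 * C / r).
Proof.
move=> r0 aC wr zr; have r20 : r / 2 <= r by rewrite ler_pdivrMr// ler_pMr// ler1n.
have wr' := le_trans wr r20; have zr' := le_trans zr r20.
have key N : normc (germ_eval w a - germ_eval z a) <=
    normc (w - z) * (2 * C / r) + 2 * C * 2^-1 ^+ N.
  elim: N a C aC => [|N IH] a C aC.
    have C0 := majorized_ge0 aC.
    rewrite expr0 mulr1 ler_wpDl//; first by rewrite !mulr_ge0 ?normc_ge0// invr_ge0 ltW.
    apply: le_trans (normc_le_add _ _) _; rewrite normc_opp mulr_natl mulr2n lerD//.
      exact: (germ_eval_le wr').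
    exact: (germ_eval_le zr').
  have tC := majorized_tail r0 aC.
  rewrite (germ_eval_tail r0 wr' aC) (germ_eval_tail r0 zr' aC).
  set A := germ_eval w _; set B := germ_eval z _.
  have -> : a 0%N + w * A - (a 0%N + z * B) = (w - z) * A + z * (A - B) by ring.
  apply: le_trans (normc_le_add _ _) _; rewrite !normcM.
  have h1 : normc (w - z) * normc A <= normc (w - z) * (C / r).
    by rewrite ler_wpM2l ?normc_ge0//; exact: (germ_eval_le wr').
  have h2 : normc z * normc (A - B) <=
      r / 2 * (normc (w - z) * (2 * (C / r) / r) + 2 * (C / r) * 2^-1 ^+ N).
    by apply: ler_pM; rewrite ?normc_ge0//; exact: IH.
  apply: le_trans (lerD h1 h2) _; rewrite le_eqVlt; apply/orP; left; apply/eqP.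
  by rewrite exprS; field; rewrite gt_eqF.
have g : `|2^-1 : R| < 1 by rewrite ger0_norm// invf_lt1// ltr1n.
rewrite -subr_le0; apply: (cvgr_to_ge (@cvg_geometric R (2 * C) _ g)).
by apply: nearW => N /=; rewrite lerBlDl.
Qed.

(** With [b] the tail of [a], [a(x) - a(y) = (x - y) b(x) + y (b(x) - b(y))];
   here [b(x)] is close to [a 1] and [b] is Lipschitz. *)
Lemma germ_strict_derivative a e : 0 < e -> exists2 dl : R, 0 < dl &
  forall x y, `|x| < dl -> `|y| < dl ->
  normc (germ_eval x%:C a - germ_eval y%:C a - a 1%N * (x - y)%:C) <= e * `|x - y|.
Proof.
move=> e0; set b := germ_tail a.
have [r [C [r0 bC]]] := majorized_germ b.
have C0 := majorized_ge0 bC.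
have e20 : 0 < e / 2 by rewrite divr_gt0.
have [/= d1 d10 hd1] := germ_eval_near0 b e20.
have /= [d2 d20 hd2] := near_germ_eval_tail a.
pose d3 := (e / 2) / (2 * C / r + 1).
have k0 : 0 <= 2 * C / r by rewrite !mulr_ge0// invr_ge0 ltW.
have d30 : 0 < d3 by rewrite divr_gt0// ltr_wpDl.
exists (Num.min (Num.min d1 d2) (Num.min (r / 2) d3)).
  by rewrite !lt_min d10 d20 d30 divr_gt0.
move=> x y; rewrite !lt_min => /andP[/andP[x1 x2] /andP[x3 x4]].
move=> /andP[/andP[y1 y2] /andP[y3 y4]].
rewrite (hd2 x) ?(hd2 y)/= ?sub0r ?normrN//.
have hb : normc (germ_eval x%:C b - a 1%N) < e / 2.
  by apply: hd1; rewrite /= sub0r normrN.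
have hl : normc (germ_eval x%:C b - germ_eval y%:C b) <= normc (x%:C - y%:C) * (2 * C / r).
  by apply: germ_eval_lipschitz r0 bC _ _; rewrite normcR ltW.
have -> : a 0%N + x%:C * germ_eval x%:C b - (a 0%N + y%:C * germ_eval y%:C b)
   - a 1%N * (x - y)%:C = (x - y)%:C * (germ_eval x%:C b - a 1%N)
   + y%:C * (germ_eval x%:C b - germ_eval y%:C b).
  rewrite rmorphB /=; move: (germ_eval x%:C b) (germ_eval y%:C b) => X Y.
  by move: x%:C y%:C (a 0%N) (a 1%N) => x' y' a0 a1; ring.
apply: le_trans (normc_le_add _ _) _; rewrite !normcM !normcR.
rewrite [e]splitr mulrDl; apply: lerD; first by rewrite mulrC ler_wpM2r// ltW.
rewrite -rmorphB normcR in hl.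
apply: le_trans (ler_wpM2l (normr_ge0 y) hl) _.
rewrite mulrCA mulrC ler_wpM2r//.
apply: (@le_trans _ _ (d3 * (2 * C / r + 1))).
  by apply: ler_pM => //; [exact: ltW|rewrite lerDl].
by rewrite /d3 divfK// gt_eqF// ltr_wpDl.
Qed.

(** The factor 2 in [kappa] leaves room for the error: if [z = w / l] is
   within [|x| / 10] of the real number [x], then [|z|^2 <= 2 Re (z^2)]. *)
Lemma cone_of_direction (l w : R[i]) (x : R) : l != 0 ->
  normc (w - l * x%:C) <= normc l / 10 * `|x| ->
  cone ((2 * normc l ^+ 2)%:C / l ^+ 2) w.
Proof.
move=> l0 h; have nl : 0 < normc l by rewrite normc_gt0.
pose z := w / l; have wE : w = l * z by rewrite mulrC divfK.
have hz : normc (z - x%:C) <= `|x| / 10.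
  rewrite -(ler_pM2l nl) -normcM mulrBr -wE.
  by apply: le_trans h _; rewrite le_eqVlt; apply/orP; left; apply/eqP; field.
have hA := le_trans (Re_le_normc _) hz; have hB := le_trans (Im_le_normc _) hz.
rewrite /cone; have -> : (2 * normc l ^+ 2)%:C / l ^+ 2 * w ^+ 2 = (2 * normc l ^+ 2)%:C * z ^+ 2.
  by rewrite wE; field.
have -> : normc w ^+ 2 = normc l ^+ 2 * normc z ^+ 2 by rewrite wE normcM exprMn.
case: z {wE hz} hA hB => A B /= hA hB.
have -> : normc (A +i* B) ^+ 2 = A ^+ 2 + B ^+ 2.
  by rewrite /normc sqr_sqrtr// addr_ge0// sqr_ge0.
have -> : 2 * normc l ^+ 2 * (A * A - B * B) - 0 * (A * B + B * A) =
   normc l ^+ 2 * (2 * (A ^+ 2 - B ^+ 2)) by ring.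
rewrite ler_wpM2l ?exprn_ge0 ?(ltW nl)//.
rewrite subr0 in hB.
have x0 := normr_ge0 x.
have hA2 : `|A| >= `|x| * (9 / 10).
  have := ler_normB x (x - A); rewrite opprB addrC subrK => h1.
  have : `|x| <= `|x - A| + `|A|.
    by rewrite -{1}(subrK A x) ler_normD.
  by rewrite distrC; lra.
have : `|B| ^+ 2 <= (`|x| / 10) ^+ 2 by rewrite ler_sqr ?nnegrE ?divr_ge0.
have : (`|x| * (9 / 10)) ^+ 2 <= `|A| ^+ 2 by rewrite ler_sqr ?nnegrE ?mulr_ge0//; lra.
rewrite !real_normK ?num_real// !exprMn.
have : 0 <= `|x| ^+ 2 by exact: sqr_ge0.
lra.
Qed.

(** A parametrization of the curve at [p] is strictly differentiable there
   with a nonzero derivative, and the continuity of its inverse ensures that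
   points of the curve close to [p] have parameters close to 0. *)
Lemma analytic_curve_cone (gamma : set R[i]) (p : R[i]) :
  analytic_curve gamma -> gamma p -> exists kappa, exists2 dl : R, 0 < dl &
  forall u v, gamma u -> gamma v -> normc (u - p) < dl -> normc (v - p) < dl ->
  cone kappa (u - v).
Proof.
move=> gc gp; have [e e0 [V [f [oV Vp f0 [fim _ [g gf gc']] fA]]]] := gc p gp.
have [|[c hc] [l l0 fl]] := fA 0; first by rewrite oppr_lt0 e0.
have cc : convergent c.
  have [/= d d0 hd] := hc; have d20 : 0 < d / 2 by rewrite divr_gt0.
  have := hd (d / 2); rewrite /= sub0r normrN gtr0_norm// subr0 gtr_pMr// invf_lt1// ltr1n => /(_ isT).
  apply: pointwise_cvg_convergent.
  by rewrite -normc_gt0 normcR normr_gt0 gt_eqF.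
pose a := mk_germ cc.
have fa : \forall t \near (0 : R), f t = germ_eval t%:C a.
  apply: filterS hc => t; rewrite subr0 => ct.
  by rewrite /germ_eval (cvg_lim (@norm_hausdorff _ _) ct).
have fa0 : p = a 0%N.
  by have /= := nbhs_singleton fa; rewrite f0 germ_eval_at0.
(* The coefficient [a 1] is the derivative at 0. *)
have a1 : a 1%N != 0.
  apply/eqP => a10; have l20 : 0 < normc l / 2 by rewrite divr_gt0// normc_gt0.
  have h1 := nbhs_dnbhs (germ_eval_near0 (germ_tail a) l20).
  have h2 := nbhs_dnbhs fa.
  have h2' := nbhs_dnbhs (near_germ_eval_tail a).
  have /cvgcP/(_ _ l20) h3 := fl.
  have tn0 : \forall t \near 0^', t != 0 :> R.
    by rewrite near_withinE; apply: near0W.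
  have [t [[t1 [t2 t3]] [t4 t5]]] := filter_ex (filterI (filterI h1 (filterI h2 h2')) (filterI h3 tn0)).
  move: t1 t4; rewrite [germ_tail a 0%N]a10 subr0 add0r f0 t2 t3 fa0.
  rewrite addrAC subrr add0r mulrA -rmorphM mulVf// mul1r => t1 t4.
  have := normc_le_add (l - germ_eval t%:C (germ_tail a)) (germ_eval t%:C (germ_tail a)).
  by rewrite subrK; lra.
have e10 : 0 < normc (a 1%N) / 10 by rewrite divr_gt0// normc_gt0.
have [d d0 hd] := germ_strict_derivative a e10.
have [/= d' d'0 hd'] := fa.
have m0 : 0 < Num.min d d' by rewrite lt_min d0.
have gp0 : g p = 0 by rewrite -f0 gf//= oppr_lt0 e0.
have Up : (gamma `&` V) p by [].
have /subspace_continuousP/(_ p Up)/cvgrPdist_lt/(_ _ m0) gn := gc'.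
have nV : nbhs p V by exact: open_nbhs_nbhs.
have [dl dl0 hdl] := nbhscP (filterI nV gn).
exists ((2 * normc (a 1%N) ^+ 2)%:C / (a 1%N) ^+ 2), dl => // u v gu gv up vp.
have coord z : gamma z -> normc (z - p) < dl ->
    exists x, [/\ z = germ_eval x%:C a, `|x| < d & `|x| < d'].
  move=> gz zp; have [Vz gzn] := hdl _ zp.
  have Uz : (gamma `&` V) z by [].
  have : `|g p - g z| < Num.min d d' := gzn Uz; rewrite gp0 sub0r normrN lt_min => /andP[z1 z2].
  have [x Ix fx] : (f @` [set t | - e < t < e]) z by rewrite fim.
  exists x; rewrite -fx gf// in z1 z2 *; split=> //.
  by apply: hd'; rewrite /= sub0r normrN.
have [x [-> x1 _]] := coord _ gu up.
have [y [-> y1 _]] := coord _ gv vp.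
by apply: (@cone_of_direction _ _ (x - y)) => //; exact: hd.
Qed.

(** The roots of [P_t] that are close to a given root of [P_0] differ by
   vectors of a fixed cone. The argument 0 is excluded since the zoom divides
   by [t]. *)
Definition aligned P : Prop :=
  forall p, root (map_poly (@germ_at0 R) P) p -> exists kappa, exists2 dl : R, 0 < dl &
  \forall t \near (0 : R)^', forall u v,
    root (spec P t) u -> root (spec P t) v ->
    normc (u - p) < dl -> normc (v - p) < dl -> cone kappa (u - v).

Lemma roots_in_curve_aligned (gamma : set R[i]) P :
  analytic_curve gamma -> has_roots_in gamma P -> aligned P.
Proof.
move=> gc [r r0 [_ [s /andP[s0 _] hs]]] p rp.
have spec0 : spec P 0 = map_poly (@germ_at0 R) P.
  by apply/polyP => i; rewrite coef_spec germ_eval_at0 (coef_map (@germ_at0 R)).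
have gp : gamma p.
  by apply: (hs 0); [rewrite oppr_lt0 s0|rewrite -/(spec P 0) spec0].
have [kappa [dl dl0 h]] := analytic_curve_cone gc gp.
exists kappa, dl => //; apply: nbhs_dnbhs; apply: filterS (nbhs0_lt s0) => t ts u v ru rv.
by apply: h; apply: (hs t); rewrite -?ltr_norml.
Qed.

End Curves.

(** * The sum of the squared differences of the roots *)

Section Discriminant.
Variable R : realType.
Implicit Types (s : seq R[i]).

(** The sum of the squares of all the differences of the roots of [p], for [p]
   monic of degree [n.+2] ([sum_sqr_diff_roots]). *)
Definition spread (K : comNzRingType) n (p : {poly K}) : K :=
  p`_n.+1 ^+ 2 *+ (2 * n.+1) - p`_n *+ (4 * n.+2).

Lemma sum_sqr_roots s n : size s = n.+2 ->
  \sum_(x <- s) x ^+ 2 =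
  (\prod_(x <- s) ('X - x%:P))`_n.+1 ^+ 2 - (\prod_(x <- s) ('X - x%:P))`_n *+ 2.
Proof.
elim: n s => [|n IH] [//|x s] [ss].
  case: s ss => [//|y [|//]] _; rewrite !big_cons !big_nil mulr1 addr0.
  rewrite !mulrBl !coefB !coefXM !coefCM !coefB !coefX !coefC /=; ring.
have := IH _ ss.
have h1 : (\prod_(x <- s) ('X - x%:P))`_n.+1 = - \sum_(x <- s) x.
  have := @coefPn_prod_XsubC _ s; rewrite ss /= => -> //.
have h2 : (\prod_(x <- s) ('X - x%:P))`_n.+2 = 1.
  have := monic_prod_XsubC s xpredT id => /monicP.
  by rewrite /lead_coef size_prod_XsubC ss.
rewrite !big_cons => ->; rewrite !mulrBl !coefB !coefXM /= !coefCM h1 h2.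
ring.
Qed.

Lemma sum_sqr_diff_roots s n : size s = n.+2 ->
  \sum_(x <- s) \sum_(y <- s) (x - y) ^+ 2 = spread n (\prod_(x <- s) ('X - x%:P)).
Proof.
move=> ss; have := sum_sqr_roots ss; rewrite /spread.
have -> : (\prod_(x <- s) ('X - x%:P))`_n.+1 = - \sum_(x <- s) x.
  have := @coefPn_prod_XsubC _ s; rewrite ss /= => -> //.
set S1 := \sum_(x <- s) x; set S2 := \sum_(x <- s) x ^+ 2; set b := _`_n => S2E.
have -> : \sum_(x <- s) \sum_(y <- s) (x - y) ^+ 2 =
    \sum_(x <- s) (x ^+ 2 *+ n.+2 + S2 - x * S1 *+ 2).
  apply: eq_bigr => x _; rewrite -ss.
  under eq_bigr do rewrite sqrrB addrAC.
  rewrite sumrB big_split/= big_const_seq count_predT iter_addr addr0 sumrMnl.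
  by rewrite -mulr_sumr.
rewrite sumrB big_split/= !sumrMnl big_const_seq count_predT iter_addr addr0.
rewrite -mulr_suml -/S2 -/S1 ss S2E; ring.
Qed.

(** The coefficient of index [i] is, up to sign, an elementary symmetric
   function of degree [size s - i]. The factor [2 ^+ size s] is a crude bound
   for a binomial coefficient. *)
Lemma coef_prod_bound s A i : 0 <= A -> (forall x, x \in s -> normc x <= A) ->
  (i <= size s)%N ->
  normc (\prod_(x <- s) ('X - x%:P))`_i <= 2 ^+ size s * A ^+ (size s - i).
Proof.
move=> A0; elim: s i => [|x s IH] i sA.
  by rewrite leqn0 => /eqP ->; rewrite big_nil coef1/= normc1 !expr0 mulr1.
have sA' y : y \in s -> normc y <= A by move=> ys; apply: sA; rewrite inE ys orbT.
have xA : normc x <= A by apply: sA; rewrite inE eqxx.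
rewrite big_cons mulrBl coefB coefXM coefCM /=.
have t0 k : 0 <= 2 ^+ size s * A ^+ k by rewrite mulr_ge0 ?exprn_ge0.
case: i => [_|j] /=.
  rewrite sub0r normc_opp normcM subn0 !exprS -mulrA.
  apply: (@le_trans _ _ (A * (2 ^+ size s * A ^+ size s))).
    by apply: ler_pM; rewrite ?normc_ge0// -{2}(subn0 (size s)) IH.
  rewrite (mulrCA (2 ^+ _)) mulrA [leRHS]mulrA ler_wpM2r ?exprn_ge0//.
  by rewrite mulr_natl mulr2n lerDl mulr_ge0 ?exprn_ge0.
rewrite ltnS subSS => js; apply: le_trans (normc_le_add _ _) _.
rewrite normc_opp exprS -mulrA mulr_natl mulr2n lerD ?IH// normcM.
move: js; rewrite leq_eqVlt => /orP[/eqP ->|js].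
  by rewrite nth_default ?normc0 ?mulr0// size_prod_XsubC.
rewrite -(subnSK js) exprS mulrCA; apply: ler_pM; rewrite ?normc_ge0//.
exact: IH.
Qed.

End Discriminant.

(** * Separating the clusters of roots *)

Section Splitting.
Variable R : realType.
Implicit Types (a b c : germ R) (C : R) (t : R) (P Q : {poly germ R}).
Local Notation T := (germ_var R).
Local Notation at0 := (map_poly (@germ_at0 R)).

Definition splits P := exists s : seq (germ R), P = \prod_(a <- s) ('X - a%:P).

Lemma splitsM P Q : splits P -> splits Q -> splits (P * Q).
Proof. by move=> [s ->] [s' ->]; exists (s ++ s'); rewrite big_cat. Qed.

Lemma aligned_dvd P Q : aligned (P * Q) -> aligned P.
Proof.
move=> al p rp; have [|kappa [dl dl0 h]] := al p.
  by rewrite rmorphM /= rootM rp.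
exists kappa, dl => //; apply: filterS2 h (nbhs_dnbhs (near_specM P Q)) => t h e u v ru rv.
by apply: h; rewrite e rootM ?ru ?rv.
Qed.

Lemma roots_of_monic (p : {poly R[i]}) : p \is monic ->
  exists s : seq R[i], [/\ p = \prod_(x <- s) ('X - x%:P), (size s).+1 = size p
    & forall x, x \in s = root p x].
Proof.
move=> pm; have [s ps] := closed_field_poly_normal p.
move: ps; rewrite (monicP pm) scale1r => ps; exists s; split=> //.
  by rewrite ps size_prod_XsubC.
by move=> x; rewrite ps root_prod_XsubC.
Qed.

Lemma near_spec_inj P Q : (\forall t \near (0 : R)^', spec P t = spec Q t) -> P = Q.
Proof.
move=> h; apply/polyP => i; apply/eqP; rewrite -subr_eq0; apply/eqP.
apply: germ_eval_eq0.
apply: filterS3 h (nbhs_dnbhs (near_germ_evalD P`_i (- Q`_i)))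
  (nbhs_dnbhs (near_germ_evalN Q`_i)) => t h -> ->.
by rewrite -!coef_spec h subrr.
Qed.

(** If [P_0] has a root [p] and is not a power of [z - p], it is the product
   of such a power and of a nonconstant polynomial that does not vanish at
   [p]; Hensel's lemma lifts this factorization. *)
Lemma split_clusters n P : P \is monic -> aligned P -> (1 < size P)%N ->
  (size P <= n.+1)%N ->
  (forall Q, Q \is monic -> aligned Q -> (size Q <= n)%N -> splits Q) ->
  (forall p, at0 P <> ('X - p%:P) ^+ (size P).-1) -> splits P.
Proof.
move=> Pm al sP sPn IH notpow.
have P0m : at0 P \is monic by exact: monic_map.
have sP0 : size (at0 P) = size P by rewrite size_map_poly_id0// (monicP Pm) oner_neq0.
have [s [Ps ss sr]] := roots_of_monic P0m.
have [p ps] : exists p, p \in s.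
  by case: s ss {Ps sr} => [|p s] ss; [move: sP; rewrite -sP0 -ss|exists p; rewrite inE eqxx].
have [k [q]] := multiplicity_XsubC (at0 P) p.
rewrite monic_neq0//= => nqp P0E.
have k0 : (0 < k)%N.
  case: k P0E => // P0E; move: ps; rewrite sr P0E mulr1 => /idP qp.
  by rewrite qp in nqp.
have Xkm : ('X - p%:P) ^+ k \is monic by rewrite monic_exp// monicXsubC.
have qm : q \is monic by rewrite -(monicMr q Xkm) -P0E.
have sXk : size (('X - p%:P) ^+ k) = k.+1 by rewrite size_exp_XsubC.
have co : coprimep q (('X - p%:P) ^+ k).
  by apply: coprimep_expr; rewrite coprimep_XsubC.
have [Q [S [Qm Sm sQ sS PQS]]] := hensel Pm qm Xkm co P0E.
have sq : (size q + k.+1)%N = (size P).+1.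
  have := size_monicM (p := q) (q := ('X - p%:P) ^+ k) qm (monic_neq0 Xkm).
  rewrite -P0E sP0 sXk addnS /= => ->.
  by [].
have q1 : (1 < size q)%N.
  rewrite ltnNge; apply/negP => q1; apply: (notpow p).
  have sq1 : size q = 1%N.
    by apply/eqP; rewrite eqn_leq q1 size_poly_gt0 monic_neq0.
  have qE : q = 1.
    by have /eqP/size_poly1P[c _ qc] := sq1; move: qm; rewrite qc monicE lead_coefC => /eqP ->.
  have -> : (size P).-1 = k by move: sq; rewrite sq1 => -[<-].
  by rewrite P0E qE mul1r.
have arith (x z l m : nat) : (x + l.+1 = z.+1 -> 0 < l -> 1 < x -> z <= m.+1 ->
  x <= m /\ l.+1 <= m)%N by clear; lia.
have [sqn skn] := arith _ _ _ _ sq k0 q1 sPn.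
rewrite PQS; apply: splitsM; apply: IH => //.
- by apply: (@aligned_dvd Q S); rewrite -PQS.
- by rewrite sQ.
- by apply: (@aligned_dvd S Q); rewrite mulrC -PQS.
- by rewrite sS sXk.
Qed.

(** For a root [u] of [P_t], [(u - p)^d] is the value at [u] of [P_0 - P_t],
   whose coefficients are small. If [|u - p| >= dl], this value is less than
   [|u - p|^d], as [|u|] is at most [|u - p|] times a constant. *)
Lemma near_roots_cluster P p dl : P \is monic -> 0 < dl ->
  at0 P = ('X - p%:P) ^+ (size P).-1 ->
  \forall t \near (0 : R), forall u, root (spec P t) u -> normc (u - p) < dl.
Proof.
move=> Pm dl0 P0; set d := (size P).-1 in P0.
have sP : size P = d.+1 by rewrite prednK// size_poly_gt0 monic_neq0.
(* If [|u - p| >= dl], then [|u|^i <= B |u - p|^d] for all [i <= d]. *)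
pose A := normc p + 1; pose B := (1 + A / dl) ^+ d.
have A0 : 1 <= A by rewrite lerDr normc_ge0.
have Adl : 0 <= A / dl by rewrite divr_ge0 ?(ltW dl0)// (le_trans ler01).
have B1 : 1 <= B by rewrite exprn_ege1// lerDl.
have eta0 : 0 < (B * (2 * d.+1%:R))^-1.
  by rewrite invr_gt0 mulr_gt0// (lt_le_trans ltr01).
have := spec_near d (fun i => germ_eval_near0 P`_i eta0).
set eta := _^-1 in eta0 *.
apply: filterS => t ht u ru; rewrite ltNge; apply/negP => hu.
have u0 : 0 < normc (u - p) by exact: lt_le_trans hu.
have ub : normc u <= normc (u - p) + A.
  by rewrite -{1}(subrK p u); apply: le_trans (normc_le_add _ _) _; rewrite lerD2l lerDl.
have vA : normc (u - p) + A <= normc (u - p) * (1 + A / dl).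
  rewrite mulrDr mulr1 lerD2l mulrA ler_pdivlMr// mulrC ler_wpM2r// (le_trans ler01)//.
have key : (u - p) ^+ d = - \sum_(i < d) (germ_eval t%:C P`_i - P`_i 0%N) * u ^+ i.
  have : (spec P t).[u] = 0 by apply/eqP.
  have -> : (u - p) ^+ d = (at0 P).[u] by rewrite P0 horner_exp hornerXsubC.
  have sS : (size (spec P t) <= d.+1)%N by rewrite -sP; exact: size_spec.
  have s0 : (size (at0 P) <= d.+1)%N by rewrite P0 size_exp_XsubC.
  rewrite (horner_coef_wide _ sS) (horner_coef_wide _ s0) !big_ord_recr/=.
  have m1 : P`_d = 1 by rewrite -(monicP Pm) /lead_coef sP.
  have -> : (spec P t)`_d = 1 by rewrite coef_spec m1 germ_eval1.
  have -> : (at0 P)`_d = 1 by rewrite (coef_map (@germ_at0 R)) m1.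
  under [X in _ -> _ = - X]eq_bigr do rewrite mulrBl.
  rewrite sumrB opprB => /eqP; rewrite addr_eq0 => /eqP h.
  under [X in _ = _ - X]eq_bigr do rewrite -coef_spec.
  rewrite h opprK; congr (_ + _).
  by apply: eq_bigr => i _; rewrite (coef_map (@germ_at0 R)).
have : normc ((u - p) ^+ d) <= \sum_(i < d) eta * (normc (u - p) ^+ d * B).
  rewrite key normc_opp; apply: le_trans (normc_le_sum _) _; apply: ler_sum => i _.
  rewrite normcM; apply: ler_pM; rewrite ?normc_ge0//; first by apply/ltW/ht.
  rewrite normcX /B -exprMn; apply: (@le_trans _ _ ((normc (u - p) + A) ^+ i)).
    by rewrite lerXn2r ?nnegrE ?normc_ge0// addr_ge0 ?normc_ge0// (le_trans ler01).
  apply: (@le_trans _ _ ((normc (u - p) + A) ^+ d)).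
    apply: ler_weXn2l; last exact: ltnW.
    by apply: le_trans A0 _; rewrite lerDr normc_ge0.
  rewrite lerXn2r ?nnegrE//; first by rewrite addr_ge0 ?normc_ge0// (le_trans ler01).
  by rewrite mulr_ge0 ?normc_ge0// addr_ge0.
rewrite sumr_const card_ord normcX leNgt => /negP; apply.
have -> : eta * (normc (u - p) ^+ d * B) *+ d = normc (u - p) ^+ d * (d%:R / (2 * d.+1%:R)).
  rewrite /eta -mulr_natl; field.
  by rewrite !gt_eqF ?(lt_le_trans ltr01)// lerDl.
rewrite gtr_pMr ?exprn_gt0// ltr_pdivrMr ?mulr_gt0// mul1r.
rewrite -natrM ltr_nat.
exact: ltn_trans (ltnSn d) (ltn_Pmull _ _).
Qed.

End Splitting.

(** * The size of a cluster *)

Section Cluster.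
Variable R : realType.
Implicit Types (a b c : germ R) (C : R) (t : R) (P Q : {poly germ R}).
Implicit Types (s : seq R[i]) (kappa : R[i]).
Local Notation T := (germ_var R).
Local Notation at0 := (map_poly (@germ_at0 R)).

Lemma ReD (x y : R[i]) : complex.Re (x + y) = complex.Re x + complex.Re y.
Proof. by case: x; case: y. Qed.

Lemma Re_sum (I : Type) (r : seq I) (F : I -> R[i]) :
  complex.Re (\sum_(i <- r) F i) = \sum_(i <- r) complex.Re (F i).
Proof. exact: (big_morph (@complex.Re R) ReD). Qed.

Lemma ReZ (x : R) (z : R[i]) : complex.Re (x%:C * z) = x * complex.Re z.
Proof. by case: z => a b /=; rewrite mul0r subr0. Qed.

Lemma normc_sum_seq (I : Type) (r : seq I) (F : I -> R[i]) :
  normc (\sum_(i <- r) F i) <= \sum_(i <- r) normc (F i).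
Proof.
elim/big_ind2 : _ => [|x u y v xu yv|//]; first by rewrite normc0.
by apply: le_trans (normc_le_add _ _) _; exact: lerD.
Qed.

Lemma cone_scale kappa (x : R) (w : R[i]) : x != 0 ->
  cone kappa (x%:C * w) -> cone kappa w.
Proof.
move=> x0; rewrite /cone normcM normcR !exprMn real_normK ?num_real//.
have -> : x%:C ^+ 2 = (x ^+ 2)%:C by rewrite rmorphXn.
by rewrite (mulrCA kappa) ReZ ler_pM2l// exprn_even_gt0.
Qed.

Lemma near_spread n P : \forall t \near (0 : R),
  germ_eval t%:C (spread n P) = spread n (spec P t).
Proof.
pose a := P`_n.+1 ^+ 2 *+ (2 * n.+1); pose b := P`_n *+ (4 * n.+2).
apply: filterS3 (near_germ_evalD a (- b)) (near_germ_evalN b)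
  (filterI (filterI (near_germ_evalMn (P`_n.+1 ^+ 2) (2 * n.+1))
     (near_germ_evalX P`_n.+1 2)) (near_germ_evalMn P`_n (4 * n.+2))) => t.
by rewrite /spread !coef_spec -/a -/b => -> -> [[-> ->] ->].
Qed.

Lemma spread_at0 n P : germ_at0 (spread n P) = spread n (at0 P).
Proof.
rewrite /spread !(coef_map (@germ_at0 R)) (rmorphB (@germ_at0 R)).
by rewrite !(rmorphMn (@germ_at0 R)) (rmorphXn (@germ_at0 R)).
Qed.

Lemma cone_spread kappa s n : size s = n.+2 ->
  (forall x y, x \in s -> y \in s -> cone kappa (x - y)) ->
  let D := spread n (\prod_(x <- s) ('X - x%:P)) in
  normc D <= complex.Re (kappa * D) /\
  forall x y, x \in s -> y \in s -> normc (x - y) ^+ 2 <= complex.Re (kappa * D).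
Proof.
move=> ss sc D; have DE : D = \sum_(x <- s) \sum_(y <- s) (x - y) ^+ 2.
  by rewrite (sum_sqr_diff_roots ss).
have sumle : \sum_(x <- s) \sum_(y <- s) normc (x - y) ^+ 2 <= complex.Re (kappa * D).
  rewrite DE mulr_sumr Re_sum big_seq [leRHS]big_seq; apply: ler_sum => x xs.
  rewrite mulr_sumr Re_sum big_seq [leRHS]big_seq; apply: ler_sum => y ys.
  exact: sc.
split.
  apply: le_trans sumle; rewrite DE; apply: le_trans (normc_sum_seq _ _) _.
  apply: ler_sum => x _; apply: le_trans (normc_sum_seq _ _) _.
  by apply: ler_sum => y _; rewrite normcX.
move=> x y xs ys; apply: le_trans sumle.
have ge0 (z w : R[i]) : 0 <= normc (z - w) ^+ 2 by exact: sqr_ge0.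
rewrite (big_rem x xs)/= (big_rem y ys)/= -addrA lerDl addr_ge0//.
  exact: sumr_ge0.
by apply: sumr_ge0 => z _; apply: sumr_ge0.
Qed.

(** Once all the roots are in one cluster, the cone condition holds for all
   pairs of roots, with no restriction on their location. It remains so after
   a zoom, when the roots no longer form a cluster. *)
Definition globally_aligned kappa P : Prop := \forall t \near (0 : R)^', forall u v,
    root (spec P t) u -> root (spec P t) v -> cone kappa (u - v).

Lemma cluster_globally_aligned P p : P \is monic -> aligned P -> (1 < size P)%N ->
  at0 P = ('X - p%:P) ^+ (size P).-1 -> exists kappa, globally_aligned kappa P.
Proof.
move=> Pm al sP P0; have [|kappa [dl dl0 h]] := al p.
  by rewrite P0 /root horner_exp hornerXsubC subrr expr0n; case: (size P) sP => [|[]].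
exists kappa; apply: filterS2 h (nbhs_dnbhs (near_roots_cluster Pm dl0 P0)) => t h hc u v ru rv.
by apply: h => //; exact: hc.
Qed.

Lemma near_roots n P kappa : P \is monic -> size P = n.+3 -> globally_aligned kappa P ->
  \forall t \near (0 : R)^', exists s, [/\ spec P t = \prod_(x <- s) ('X - x%:P),
   size s = n.+2,
   normc (germ_eval t%:C (spread n P)) <= complex.Re (kappa * germ_eval t%:C (spread n P))
   & forall x y, x \in s -> y \in s ->
     normc (x - y) ^+ 2 <= complex.Re (kappa * germ_eval t%:C (spread n P))].
Proof.
move=> Pm sP ga; apply: filterS2 ga (nbhs_dnbhs (near_spread n P)) => t h ->.
have [Sm sS] := spec_monic t Pm.
have [s [Ps ss sr]] := roots_of_monic Sm.
have ss' : size s = n.+2 by move: ss; rewrite sS sP => -[].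
exists s; rewrite {2 3 4}Ps.
have [] := @cone_spread kappa s n ss' => [x y|h1 h2].
  by rewrite !sr; exact: h.
by split.
Qed.

(** The mean of the roots, when [P] is monic of degree [n.+2]. *)
Definition mean_root n P : germ R := germ_const (- n.+2%:R^-1) * P`_n.+1.

Lemma near_mean_root n P : \forall t \near (0 : R), forall s,
  spec P t = \prod_(x <- s) ('X - x%:P) -> size s = n.+2 ->
  germ_eval t%:C (mean_root n P) *+ n.+2 = \sum_(x <- s) x.
Proof.
apply: filterS (near_germ_evalM (germ_const (- n.+2%:R^-1)) P`_n.+1) => t h s Ps ss.
rewrite [germ_eval _ _]h germ_eval_const -coef_spec Ps.
have := @coefPn_prod_XsubC _ s; rewrite ss /= => -> //.
by rewrite mulrNN -mulrnAl -[_ *+ _]mulr_natl mulfV ?mul1r.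
Qed.

Lemma spread_eq0_splits n P kappa : P \is monic -> size P = n.+3 ->
  globally_aligned kappa P -> spread n P = 0 -> splits P.
Proof.
move=> Pm sP ga D0; pose c := mean_root n P.
exists (nseq n.+2 c); apply: near_spec_inj.
apply: filterS3 (near_roots Pm sP ga) (nbhs_dnbhs (near_mean_root n P))
  (nbhs_dnbhs (near_spec_prod (nseq n.+2 c))) => t [s [Ps ss _ h]] /(_ s Ps ss) hm ->.
rewrite Ps; have eqs x y : x \in s -> y \in s -> x = y.
  move=> xs ys; have := h x y xs ys; rewrite D0 germ_eval0 mulr0 /= => le0.
  apply/eqP; rewrite -subr_eq0 -normc_eq0 -sqrf_eq0; apply/eqP/le_anti.
  by rewrite le0 exprn_ge0// normc_ge0.
have [x xs] : exists x, x \in s.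
  by case: s ss {Ps h hm eqs} => // x s _; exists x; rewrite inE eqxx.
have sE : s = nseq n.+2 x.
  by rewrite -ss; apply/all_pred1P/allP => y ys; apply/eqP; exact: eqs.
have cx : germ_eval t%:C c = x.
  apply: (@mulIf _ n.+2%:R); first by rewrite pnatr_eq0.
  by rewrite !mulr_natr hm sE big_nseq iter_addr addr0.
by rewrite sE !big_nseq cx.
Qed.

(** If [a = t^k b] and [k] is odd, then [Re (kappa b(t))] is at least [|b(t)|]
   for [t > 0] and at most [- |b(t)|] for [t < 0]. This is impossible since
   [b] is continuous and nonzero at 0. *)
Lemma order_even k b kappa : b 0%N <> 0 ->
  (\forall t \near (0 : R)^', normc (germ_eval t%:C (T ^+ k * b)) <=
      complex.Re (kappa * germ_eval t%:C (T ^+ k * b))) -> ~~ odd k.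
Proof.
move=> b0 h; apply/negP => ok.
have B0 : 0 < normc (b 0%N) by rewrite normc_gt0; apply/eqP.
pose e := normc (b 0%N) / (2 * (1 + normc kappa)).
have K0 : 0 < 2 * (1 + normc kappa) by rewrite mulr_gt0// ltr_wpDr// normc_ge0.
have e0 : 0 < e by rewrite divr_gt0.
have h1 := nbhs_dnbhs (near_germ_evalM (T ^+ k) b).
have h2 := nbhs_dnbhs (near_germ_evalX T k).
have h3 := nbhs_dnbhs (germ_eval_near0 b e0).
have [dl /= dl0 hd] := filterI (filterI h h1) (filterI h2 h3).
have get t : t != 0 -> `|t| < dl -> normc (germ_eval t%:C b) * `|t| ^+ k <=
    t ^+ k * complex.Re (kappa * germ_eval t%:C b) /\ normc (germ_eval t%:C b - b 0%N) < e.
  move=> t0 tdl; have [|] := hd t _ t0; first by rewrite /= sub0r normrN.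
  move=> [g1 g2] [g3 g4]; split=> //; move: g1; rewrite g2 g3 germ_eval_var.
  have -> : t%:C ^+ k = (t ^+ k)%:C by rewrite rmorphXn.
  by rewrite normcM normcR normrX (mulrCA kappa) ReZ mulrC.
have d2 : 0 < dl / 2 by rewrite divr_gt0.
have dl2 : dl / 2 < dl by rewrite gtr_pMr// invf_lt1// ltr1n.
have dlp : dl / 2 != 0 by rewrite gt_eqF.
have [//||p1 p2] := get (dl / 2); first by rewrite gtr0_norm.
rewrite gtr0_norm// mulrC ler_pM2l ?exprn_gt0// in p1.
have [||n1 n2] := get (- (dl / 2)); rewrite ?oppr_eq0// ?normrN ?gtr0_norm//.
rewrite normrN gtr0_norm// exprNn -signr_odd ok expr1 mulN1r mulNr -mulrN mulrC in n1.
rewrite ler_pM2l ?exprn_gt0// in n1.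
move: p1 p2 n1 n2.
move: (germ_eval _ b) (germ_eval _ b) => Y X p1 p2 n1 n2.
have tri z : normc (z - b 0%N) < e -> normc (b 0%N) <= normc z + e.
  by move=> h'; have := normc_le_add (b 0%N - z) z; rewrite subrK normcB; lra.
have q1 := tri X p2; have q2 := tri Y n2.
have q3 : complex.Re (kappa * X) - complex.Re (kappa * Y) <= normc kappa * (e + e).
  have -> : complex.Re (kappa * X) - complex.Re (kappa * Y) =
      complex.Re (kappa * ((X - b 0%N) - (Y - b 0%N))).
    have -> : X - b 0%N - (Y - b 0%N) = X - Y by rewrite opprB addrA subrK.
    by rewrite mulrBr; case: (kappa * X); case: (kappa * Y).
  apply: le_trans (ler_norm _) _; apply: le_trans (Re_le_normc _) _.
  rewrite normcM ler_wpM2l ?normc_ge0//; apply: le_trans (normc_le_add _ _) _.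
  by rewrite normc_opp lerD ?ltW.
(* [e] was chosen for this contradiction with [q1], [q2] and [q3]. *)
have eE : 2 * e * (1 + normc kappa) = normc (b 0%N).
  by rewrite /e; field; rewrite gt_eqF// ltr_wpDr// normc_ge0.
have : 2 * e * (1 + normc kappa) = 2 * e + normc kappa * (e + e) by ring.
lra.
Qed.

Lemma comp_scaleX (P : {poly germ R}) a i : (P \Po (a *: 'X))`_i = a ^+ i * P`_i.
Proof.
rewrite comp_polyE coef_sum.
under eq_bigr do rewrite exprZn coefZ coefZ coefXn.
have [iP|Pi] := ltnP i (size P).
  rewrite (bigD1 (Ordinal iP))//= eqxx mulr1 mulrC big1 ?addr0// => j ji.
  have /negPf -> : i != j :> nat by apply: contraNneq ji => ij; apply/eqP/val_inj.
  by rewrite !mulr0.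
rewrite nth_default// mulr0 big1// => j _.
by have /negPf -> : i != j :> nat; [rewrite gtn_eqF// (leq_trans (ltn_ord j))|rewrite !mulr0].
Qed.

(** The squares of the differences of the roots are at most [Re (kappa D)],
   where [D = t^(2 m) b]. *)
Lemma mean_root_close n P kappa m b : P \is monic -> size P = n.+3 ->
  globally_aligned kappa P -> spread n P = T ^+ m.*2 * b ->
  exists C, 0 <= C /\ \forall t \near (0 : R)^', exists s,
    [/\ spec P t = \prod_(x <- s) ('X - x%:P), size s = n.+2 &
     forall x, x \in s -> normc (x - germ_eval t%:C (mean_root n P)) <= C * `|t| ^+ m].
Proof.
move=> Pm sP ga DE; have [B [B0 hB]] := germ_eval_bounded b.
(* Adding 1 makes [C <= C^2], which avoids a square root. *)
pose C := normc kappa * B + 1; have C1 : 1 <= C by rewrite lerDr mulr_ge0// normc_ge0.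
have C0 : 0 <= C := le_trans ler01 C1.
exists C; split=> //.
have h1 := nbhs_dnbhs (near_germ_evalM (T ^+ m.*2) b).
have h2 := nbhs_dnbhs (near_germ_evalX T m.*2).
apply: filterS3 (near_roots Pm sP ga) (nbhs_dnbhs (near_mean_root n P))
  (filterI (nbhs_dnbhs hB) (filterI h1 h2)) => t [s [Ps ss _ h]] /(_ s Ps ss) hm [hb [g1 g2]].
have key x y : x \in s -> y \in s -> normc (x - y) <= C * `|t| ^+ m.
  move=> xs ys; rewrite -ler_sqr ?nnegrE ?normc_ge0 ?mulr_ge0 ?exprn_ge0//.
  apply: le_trans (h x y xs ys) _; rewrite DE g1 g2 germ_eval_var.
  apply: le_trans (ler_norm _) _; apply: le_trans (Re_le_normc _) _.
  rewrite mulrCA normcM normcX normcR exprMn -exprM muln2 mulrC ler_wpM2r ?exprn_ge0//.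
  rewrite normcM; apply: (@le_trans _ _ C).
    by rewrite /C ler_wpDr// ler_wpM2l// normc_ge0.
  by rewrite expr2 ler_peMr.
exists s; split=> // x xs; set c := germ_eval _ _ in hm *.
have N0 : 0 < n.+2%:R :> R by rewrite ltr0n.
rewrite -(ler_pM2l N0) mulr_natl -normcMn mulrnBl hm -ss.
have -> : x *+ size s - \sum_(y <- s) y = \sum_(y <- s) (x - y).
  by rewrite sumrB big_const_seq count_predT iter_addr addr0.
apply: le_trans (normc_sum_seq _ _) _; rewrite mulr_natl.
have -> : C * `|t| ^+ m *+ size s = \sum_(y <- s) C * `|t| ^+ m.
  by rewrite big_const_seq count_predT iter_addr addr0.
by rewrite big_seq [leRHS]big_seq; apply: ler_sum => y ys; exact: key.
Qed.

End Cluster.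

(** * Zooming into a cluster *)

Section Main.
Variable R : realType.
Implicit Types (a b c : germ R) (C : R) (t : R) (P Q : {poly germ R}).
Implicit Types (s : seq R[i]) (kappa : R[i]).
Local Notation T := (germ_var R).
Local Notation at0 := (map_poly (@germ_at0 R)).

Lemma spread_XsubC_exp n (p : R[i]) : spread n (('X - p%:P) ^+ n.+2) = 0.
Proof.
have -> : ('X - p%:P) ^+ n.+2 = \prod_(x <- nseq n.+2 p) ('X - x%:P).
  by rewrite big_nseq iter_mulr_1.
rewrite -sum_sqr_diff_roots ?size_nseq// big1_seq// => x; rewrite mem_nseq => /eqP ->.
by rewrite big1_seq// => y; rewrite mem_nseq => /eqP ->; rewrite subrr expr0n.
Qed.

Lemma prod_comp_XaddC s (z : R[i]) :
  (\prod_(x <- s) ('X - x%:P)) \Po ('X + z%:P) =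
  \prod_(x <- [seq x - z | x <- s]) ('X - x%:P).
Proof.
rewrite big_map rmorph_prod/=; apply: eq_bigr => x _.
by rewrite comp_polyB comp_polyX comp_polyC polyCB opprB addrA addrAC.
Qed.

Lemma near_spec_XaddC c : \forall t \near (0 : R),
  spec ('X + c%:P) t = 'X + (germ_eval t%:C c)%:P.
Proof.
apply: filterS2 (near_spec_XsubC (- c)) (near_germ_evalN c) => t.
by rewrite polyCN opprK => -> ->; rewrite polyCN opprK.
Qed.

(** Zero divisors do no harm: the leading term comes from the power [('X +
   c%:P) ^+ d], which is monic. *)
Lemma monic_translate (K : comNzRingType) (p : {poly K}) (c : K) : p \is monic ->
  p \Po ('X + c%:P) \is monic /\ size (p \Po ('X + c%:P)) = size p.
Proof.
move=> pm; set d := (size p).-1.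
have sp : size p = d.+1 by rewrite prednK// size_poly_gt0 monic_neq0.
pose p0 := p - 'X^d.
have p0d : (size p0 <= d)%N.
  apply/leq_sizeP => j; rewrite leq_eqVlt coefB coefXn => /orP[/eqP <-|dj].
    by rewrite -[p`_d]/(lead_coef p) (monicP pm) eqxx subrr.
  by rewrite nth_default ?sp// gtn_eqF// subr0.
have sX : size (('X + c%:P) ^+ d) = d.+1.
  by rewrite -[c]opprK polyCN size_exp_XsubC.
have Xm : ('X + c%:P) ^+ d \is monic by rewrite monic_exp// monicXaddC.
have -> : p \Po ('X + c%:P) = ('X + c%:P) ^+ d + (p0 \Po ('X + c%:P)).
  by rewrite /p0 comp_polyB rmorphXn /= comp_polyX [RHS]addrC subrK.
have s0 : (size (p0 \Po ('X + c%:P)) < size (('X + c%:P) ^+ d)%R)%N.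
  have [->|p00] := eqVneq p0 0; first by rewrite comp_poly0 size_poly0 sX.
  rewrite sX ltnS; apply: leq_trans (size_comp_poly_leq _ _) _.
  by rewrite size_XaddC muln1 prednK// size_poly_gt0.
by rewrite monicE lead_coefDl// (monicP Xm) size_polyDl// sX sp.
Qed.

(** For each [t], a translation of the roots does not change their
   differences. *)
Lemma spread_translate n P c : P \is monic -> size P = n.+3 ->
  spread n (P \Po ('X + c%:P)) = spread n P.
Proof.
move=> Pm sP; apply/eqP; rewrite -subr_eq0; apply/eqP; apply: germ_eval_eq0.
set P1 := P \Po _.
apply: filterS3 (nbhs_dnbhs (filterI (near_germ_evalD (spread n P1) (- spread n P)) (near_germ_evalN (spread n P))))
  (nbhs_dnbhs (filterI (near_spread n P) (near_spread n P1)))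
  (nbhs_dnbhs (filterI (near_spec_comp P ('X + c%:P)) (near_spec_XaddC c))) => t.
move=> [-> ->] [-> ->] [-> ->]; apply/eqP; rewrite subr_eq0; apply/eqP.
have [Sm sS] := spec_monic t Pm.
have [s [Ps ss _]] := roots_of_monic Sm.
have ss' : size s = n.+2 by move: ss; rewrite sS sP => -[].
rewrite Ps.
rewrite prod_comp_XaddC -!sum_sqr_diff_roots ?size_map// big_map.
apply: eq_bigr => x _; rewrite big_map; apply: eq_bigr => y _.
by congr (_ ^+ 2); rewrite opprB addrA subrK.
Qed.

(** The roots of the translated polynomial are [O(|t|^m)], hence its
   coefficient of index [i] is [O(|t|^(m (d - i)))] and is divisible by that
   power of the variable. *)
Lemma zoom_exists n P kappa m b : P \is monic -> size P = n.+3 ->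
  globally_aligned kappa P -> spread n P = T ^+ m.*2 * b ->
  exists Q, [/\ Q \is monic, size Q = n.+3 &
    (P \Po ('X + (mean_root n P)%:P)) \Po (T ^+ m *: 'X) = T ^+ (m * n.+2) *: Q].
Proof.
move=> Pm sP ga DE; set c := mean_root n P; set P1 := P \Po _.
have [P1m sP1] : P1 \is monic /\ size P1 = n.+3.
  by have := monic_translate c Pm; rewrite sP.
have [C [C0 hC]] := mean_root_close Pm sP ga DE.
have dvd i : exists b, (i <= n.+2)%N -> P1`_i = T ^+ (m * (n.+2 - i)) * b.
  have [ni|ni] := leqP i n.+2; last by exists 0.
  suff [b' hb'] : exists b', P1`_i = T ^+ (m * (n.+2 - i)) * b' by exists b'.
  apply: (@germ_dvd_of_growth _ _ _ (2 ^+ n.+2 * C ^+ (n.+2 - i))).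
  apply: filterS2 hC (nbhs_dnbhs (filterI (near_spec_comp P ('X + c%:P)) (near_spec_XaddC c))) => t.
  move=> [s [Ps ss hs]] [h1 h2]; rewrite -coef_spec h1 h2 Ps prod_comp_XaddC.
  have -> : 2 ^+ n.+2 * C ^+ (n.+2 - i) * `|t| ^+ (m * (n.+2 - i)) =
     2 ^+ n.+2 * (C * `|t| ^+ m) ^+ (n.+2 - i) by rewrite exprMn exprM mulrA.
  have ss' : size [seq x - germ_eval t%:C c | x <- s] = n.+2 by rewrite size_map.
  rewrite -ss'; apply: coef_prod_bound; rewrite ?ss'//.
    by rewrite mulr_ge0// exprn_ge0.
  by move=> x /mapP[y ys ->]; exact: hs.
have [B hB] := choice dvd.
pose Q := \poly_(i < n.+3) B i.
have Btop : B n.+2 = 1.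
  have := hB n.+2 (leqnn _); rewrite subnn muln0 expr0 mul1r => <-.
  by rewrite -(monicP P1m) /lead_coef sP1.
have sQ : size Q = n.+3 by rewrite size_poly_eq// Btop oner_neq0.
exists Q; split=> //.
  by rewrite monicE /lead_coef sQ coef_poly ltnSn Btop.
apply/polyP => i; rewrite comp_scaleX coefZ coef_poly; case: ltnP => [|ni]; last first.
  by rewrite nth_default ?mulr0// sP1.
rewrite ltnS => ni; rewrite hB// -exprM mulrA -exprD; congr (T ^+ _ * _).
by rewrite -mulnDr subnKC.
Qed.

(** Two roots [u], [v] of [Q_t] come from roots of [P_t] whose difference is
   [t^m (u - v)], and [t^m] is real and nonzero. *)
Lemma zoom_aligned n P Q kappa m c : globally_aligned kappa P ->
  (P \Po ('X + c%:P)) \Po (T ^+ m *: 'X) = T ^+ (m * n) *: Q -> globally_aligned kappa Q.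
Proof.
move=> ga PQ.
have tn0 : \forall t \near (0 : R)^', t != 0 by rewrite near_withinE; apply: near0W.
have X1 : spec 'X = fun=> 'X :> {poly R[i]}.
  by apply/funext => t; rewrite -[in LHS](mul1r 'X) specMX -polyC1 specC germ_eval1 mul1r.
apply: filterS3 (filterI ga tn0)
  (nbhs_dnbhs (filterI (near_spec_comp (P \Po ('X + c%:P)) (T ^+ m *: 'X))
     (filterI (near_spec_comp P ('X + c%:P)) (near_spec_XaddC c))))
  (nbhs_dnbhs (filterI (filterI (near_germ_evalX T m) (near_germ_evalX T (m * n)))
     (filterI (near_specZ (T ^+ m) 'X) (near_specZ (T ^+ (m * n)) Q)))) => t.
move=> [h t0] [h1 [h2 h3]] [[g1 g2] [g3 g4]] u v ru rv.
rewrite PQ in h1; rewrite germ_eval_var in g1; rewrite X1 in g3.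
have tm0 : t ^+ m != 0 by rewrite expf_neq0.
have rt w : root (spec Q t) w -> root (spec P t) ((t ^+ m)%:C * w + germ_eval t%:C c).
  move=> rw; have : (spec (T ^+ (m * n) *: Q) t).[w] = 0.
    by rewrite g4 hornerZ (rootP rw) mulr0.
  rewrite h1 h2 g3 h3 g1 !horner_comp !hornerE => e; apply/rootP; rewrite -{}e.
  by rewrite rmorphXn.
have := h _ _ (rt _ ru) (rt _ rv).
rewrite opprD addrACA subrr addr0 -mulrBr.
exact: cone_scale.
Qed.

Lemma prod_comp_scaleX (K : comNzRingType) (k : K) (s : seq K) :
  k ^+ size s *: \prod_(a <- s) ('X - a%:P) =
  \prod_(a <- s) ('X - (k * a)%:P) \Po (k *: 'X).
Proof.
elim: s => [|a s IH]; first by rewrite !big_nil expr0 scale1r comp_polyC.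
rewrite !big_cons comp_polyM -IH comp_polyB comp_polyX comp_polyC /= exprS.
by rewrite polyCM mul_polyC -scalerBr -scalerAl -scalerAr scalerA.
Qed.

(** [germ_varXK] stands in for division by powers of the variable: comparing
   coefficients after the substitution suffices. *)
Lemma zoom_splits n P Q m c : size Q = n.+1 ->
  (P \Po ('X + c%:P)) \Po (T ^+ m *: 'X) = T ^+ (m * n) *: Q -> splits Q -> splits P.
Proof.
move=> sQ PQ [s Qs].
have ss : size s = n by move: sQ; rewrite Qs size_prod_XsubC => -[].
have P1 : P \Po ('X + c%:P) = \prod_(a <- s) ('X - (T ^+ m * a)%:P).
  apply/polyP => i; apply: (@germ_varXK _ (m * i)); rewrite exprM -!comp_scaleX PQ Qs.
  by rewrite -ss exprM prod_comp_scaleX.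
exists [seq T ^+ m * a + c | a <- s].
rewrite -[LHS](comp_polyXaddC_K P c) P1 rmorph_prod big_map/=; apply: eq_bigr => a _.
by rewrite comp_polyB comp_polyX comp_polyC polyCD opprD addrA addrAC.
Qed.

(** Strong induction on the degree, since Hensel's lemma gives factors of any
   lower degree. *)
Lemma aligned_splits P : P \is monic -> aligned P -> splits P.
Proof.
move: {2}(size P) (leqnn (size P)) => N; elim: N P => [|N IH] P sP Pm al.
  by move: sP (monic_neq0 Pm); rewrite leqn0 size_poly_eq0 => ->.
have [P1|P1] := leqP (size P) 1.
  exists [::]; rewrite big_nil; apply/eqP; move: Pm; rewrite (size1_polyC P1) monicE lead_coefC.
  by move=> /eqP ->.
have [[p P0]|np] := pselect (exists p, at0 P = ('X - p%:P) ^+ (size P).-1); last first.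
  apply: (split_clusters Pm al P1 sP).
    by move=> Q Qm Qal sQ; exact: IH.
  by move=> p P0; apply: np; exists p.
have [P2|P2] := leqP (size P) 2.
  exists [:: - P`_0]; rewrite big_seq1 polyCN opprK.
  have sP2 : size P = 2%N by apply/eqP; rewrite eqn_leq P2.
  apply/polyP => -[|[|i]]; rewrite coefD coefX coefC /= ?add0r ?addr0//.
    by rewrite -(monicP Pm) /lead_coef sP2.
  by rewrite nth_default ?sP2// addr0.
have [n sPn] : exists n, size P = n.+3 by case: (size P) P2 => [|[|[|n]]] // _; exists n.
have [kappa ga] := cluster_globally_aligned Pm al P1 P0.
have [D0|D0] := pselect (spread n P = 0); first exact: spread_eq0_splits ga D0.
have [k [b [DE b0]]] := germ_order D0.
have ke : ~~ odd k.
  apply: (@order_even _ k b kappa b0); rewrite -DE.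
  by apply: filterS (near_roots Pm sPn ga) => t [s []].
have kE : k = k./2.*2 by rewrite -[LHS]odd_double_half (negPf ke).
set m := k./2 in kE; rewrite kE in DE.
have [Q [Qm sQ PQ]] := zoom_exists Pm sPn ga DE.
have gaQ := zoom_aligned ga PQ.
apply: (zoom_splits sQ PQ).
have Qal : aligned Q.
  move=> q _; exists kappa, 1 => //.
  by apply: filterS gaQ => t h u v ru rv _ _; exact: h.
(* The zoom divides the differences of the roots by [t^m], hence [D = t^(2 m)
   b] by [t^(2 m)]. *)
have spQ : spread n Q = b.
  apply: (@germ_varXK _ m.*2); rewrite -DE -(spread_translate (mean_root n P) Pm sPn).
  set S := P \Po _ in PQ *.
  have cf i : T ^+ (m * i) * S`_i = T ^+ (m * n.+2) * Q`_i.
    by rewrite exprM -comp_scaleX PQ coefZ.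
  have c1 : S`_n.+1 = T ^+ m * Q`_n.+1.
    by apply: (@germ_varXK _ (m * n.+1)); rewrite cf mulrA -exprD (mulnS _ n.+1) addnC.
  have c0 : S`_n = T ^+ m.*2 * Q`_n.
    apply: (@germ_varXK _ (m * n)); rewrite cf mulrA -exprD; congr (T ^+ _ * _).
    by rewrite !mulnS addnA addnn addnC.
  by rewrite /spread c1 c0 exprMn -exprM muln2 mulrBr -!mulrnAr.
apply: (@split_clusters _ N) => //; rewrite ?sQ -?sPn//.
  by move=> S Sm Sal sS; exact: IH.
(* If [Q_0] were a power of [z - q], its spread [b(0)] would be 0. *)
move=> q Q0; apply: b0; rewrite -spQ -[LHS]/(germ_at0 _) spread_at0 Q0 sPn /=.
exact: spread_XsubC_exp.
Qed.

End Main.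

Unset Implicit Arguments.

Theorem theorem1p1 (R : realType) (gamma : set R[i])
    (P : {poly germ R}) (d : nat)
    (gamma_curve : analytic_curve gamma)
    (d_ge1 : (1 <= d)%N)
    (P_monic : P \is monic) (P_deg : size P = d.+1)
    (P_roots : has_roots_in gamma P) :
  completely_reducible P.
Proof.
have [s Ps] := aligned_splits P_monic (roots_in_curve_aligned gamma_curve P_roots).
exists [seq 'X - a%:P | a <- s]; last by rewrite big_map.
by move=> q /mapP[a _ ->]; rewrite monicXsubC size_XsubC.
Qed.
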